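(* Let $m\in\mathbb{N}$. If a sequence of maps $g_n\in\mathcal{T}_m$ converges uniformly to $f\in\mathcal{T}_m$ and if the topological entropies satisfy $h(g_n)\to h(f)$, then the constant slope models $\Phi(g_n)$ converge uniformly to $\Phi(f)$.
   Context: A continuous map $f:[0,1]\to[0,1]$ is piecewise monotone if $\mathrm{Crit}(f)=\{0,1\}\cup\{x : f \text{ is not monotone on any neighborhood of } x\}$ is finite; the modality of $f$ is the cardinality of $\mathrm{Crit}(f)\cap(0,1)$. $\mathcal{T}$ is the space of continuous, topologically transitive, piecewise monotone maps $[0,1]\to[0,1]$, and $\mathcal{T}_m\subset\mathcal{T}$ is the subspace of maps of modality $m$. $\mathcal{H}^+$ is the space of increasing homeomorphisms of $[0,1]$ onto itself. A map $f\in\mathcal{T}$ has constant slope $\lambda$ if $|f'(x)|=\lambda$ for all $x\notin\mathrm{Crit}(f)$. It is known that for each $f\in\mathcal{T}$ there are a unique map $\tilde f\in\mathcal{T}$ of some constant slope and a unique $\psi\in\mathcal{H}^+$ with $f=\psi\circ\tilde f\circ\psi^{-1}$, and that the slope of $\tilde f$ is $\exp h(f)$, where $h(f)$ is the topological entropy. Write $\Phi(f)=\tilde f$ (the constant slope model). *)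

(* Defs.v *)
From mathcomp Require Import all_boot all_order all_algebra.
From mathcomp Require Import all_classical all_reals all_analysis.

Set Implicit Arguments.
Unset Strict Implicit.
Unset Printing Implicit Defensive.

Import Order.TTheory GRing.Theory Num.Theory.
Import numFieldNormedType.Exports.

Local Open Scope classical_set_scope.
Local Open Scope ring_scope.

(* A map [0,1] -> [0,1] is represented by a function R -> R, of which only the
   restriction to [0,1] matters: every notion below, except the library's
   derivative at interior points, quantifies over points of [0,1] only. *)
Definition unitI (R : realType) : set R := `[0, 1]%classic.
Arguments unitI : clear implicits.

Section IntervalMaps.
Variable R : realType.
Implicit Types (f : R -> R) (x : R) (A U V : set R).
Local Notation I := (unitI R).

Definition continuous_self_map f : Prop :=
  {within I, continuous f} /\ (forall x, I x -> I (f x)).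

Definition monotone_on A f : Prop :=
  (forall x y, A x -> A y -> x <= y -> f x <= f y) \/
  (forall x y, A x -> A y -> x <= y -> f y <= f x).

Definition Crit f : set R :=
  [set 0; 1] `|`
  [set x | I x /\ ~ (exists2 U, nbhs x U & monotone_on (U `&` I) f)].

Definition piecewise_monotone f : Prop := finite_set (Crit f).

Definition has_modality (m : nat) f : Prop :=
  (Crit f `&` `]0, 1[%classic #= `I_m)%card.

(* The open subsets of [0,1] are the traces U `&` I with U open in R. *)
Definition transitive_map f : Prop :=
  forall U V, open U -> open V -> U `&` I !=set0 -> V `&` I !=set0 ->
  exists n : nat, (iter n f @` (U `&` I)) `&` (V `&` I) !=set0.

Definition T_space : set (R -> R) :=
  [set f | [/\ continuous_self_map f, transitive_map f & piecewise_monotone f]].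

Definition T_modality (m : nat) : set (R -> R) :=
  [set f | T_space f /\ has_modality m f].

(* psi is an increasing homeomorphism of [0,1] onto itself with inverse psi'. *)
Definition increasing_homeo (psi psi' : R -> R) : Prop :=
  [/\ continuous_self_map psi, continuous_self_map psi',
      (forall x, I x -> psi' (psi x) = x),
      (forall x, I x -> psi (psi' x) = x) &
      (forall x y, I x -> I y -> x < y -> psi x < psi y)].

Definition has_constant_slope (lambda : R) f : Prop :=
  forall x, I x -> ~ Crit f x -> derivable f x 1 /\ `|derive1 f x| = lambda.

(* The relation ft = Phi(f), where Phi sends f to its constant slope model,
   which is unique as a map on [0,1]. *)
Definition constant_slope_model f (ft : R -> R) : Prop :=
  [/\ T_space ft,
      (exists lambda : R, has_constant_slope lambda ft) &
      (exists psi psi' : R -> R, increasing_homeo psi psi' /\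
        (forall x, I x -> f x = psi (ft (psi' x))))].

(* Topological entropy in Bowen's form:
   h(f) = sup_{eps > 0} limsup_n (1/n) log s(n, eps), with s(n, eps) the
   maximal cardinality of an (n, eps)-separated set (a supremum over eps > 0 is
   the limit as eps -> 0, since s(n, eps) is nonincreasing in eps).
   A finite set is listed without repetition as a sequence. *)
Definition dyn_separated f (n : nat) (eps : R) (s : seq R) : Prop :=
  [/\ uniq s, (forall x, x \in s -> I x) &
      (forall x y, x \in s -> y \in s -> x != y ->
        exists2 k : nat, (k < n)%N & eps < `|iter k f x - iter k f y|)].

Definition max_separated f (n : nat) (eps : R) : \bar R :=
  ereal_sup [set ((size s)%:R)%:E | s in dyn_separated f n eps].

Definition top_entropy f : \bar R :=
  ereal_sup [set limn_esup
      (fun n : nat => ((n%:R^-1)%:E * lne (max_separated f n eps))%E)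
    | eps in `]0, +oo[%classic].

End IntervalMaps.

(* Main.v *)
Require Import Defs.
From mathcomp Require Import all_boot all_order all_algebra.
From mathcomp Require Import finmap.
From mathcomp Require Import all_classical all_reals all_analysis.
From mathcomp Require Import lra ring.
Set Implicit Arguments.
Unset Strict Implicit.
Unset Printing Implicit Defensive.
Import Order.TTheory GRing.Theory Num.Theory.
Import numFieldNormedType.Exports.
Local Open Scope classical_set_scope.
Local Open Scope ring_scope.

(** The entropy of a map with constant slope lam > 1 is ln lam (each Bowen ball is
    covered by few short intervals), so the slopes of Phi_g n converge to the slope
    lam of F = Phi_f. In the coordinates of F, g n becomes a map h n converging
    uniformly to F, conjugate to Phi_g n by an increasing homeomorphism p n. Let phi
    be a pointwise limit of the p n along an ultrafilter. As h n has no turning point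
    away from those of F (its modality is the same), phi is the distribution function
    of a measure which F multiplies by lam, up to possible atoms at turning points.
    Such a measure is Lebesgue measure: if r is the largest constant with
    phi v - phi u >= r (v - u), expansion shows that phi - r id is constant on some
    interval, hence, by transitivity, near all but finitely many points; the orbit of
    an atom at one of these would carry atoms of unbounded mass. So phi = id, hence
    p n converges to id uniformly and Phi_g n = p n h n (p n)^-1 to F. *)

(** The [p n] are not known to be equicontinuous, so [phi] may a priori have jumps and constant
    stretches. Two properties behave differently in the limit. The upper bound on the mass of images
    only uses that the maps [Phi_g n] are Lipschitz with constants tending to [lam]; it holds
    whatever their turning points do. The opposite bound is sensitive to folding: [h n] could fold
    in a tiny window and leave no trace in the uniform limit. Equal modality forbids this near
    affine points of [F], and nothing is claimed at turning points; hence the lower bound serves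
    only to follow single atoms through affine points. The ultrafilter plays the part of Helly's
    selection theorem: it yields the limit at all points at once, and it can be chosen to contain
    the indices where convergence is supposed to fail. Iterates of slope above 2 recur because a
    short interval contains at most one break of such an iterate, so that the longer of its two
    pieces still grows. In the entropy bound the resulting factor 2 costs [ln 2 / N], which is as
    small as desired. *)

Section Creeping.
Variable R : realType.
Implicit Types (a b x u v : R).

(** Real induction: around the supremum of the points where [P] holds, truth passes from the left to
    the right, so the supremum cannot stop before [b]. The Lebesgue number and the local-to-global
    estimates below rest on it. *)
Lemma creep (P : R -> Prop) a b : a <= b -> P a ->
  (forall x, a <= x <= b -> exists2 e, 0 < e & forall u v,
     a <= u -> x - e < u -> u <= x -> x <= v -> v < x + e -> v <= b ->
     P u -> P v) ->
  P b.
Proof.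
move=> ab Pa H.
pose S := [set x | a <= x <= b /\ P x].
have Sa : S a by split => //; lra.
have ubS : ubound S b by move=> x [/andP[]].
have hS : has_sup S by split; [exists a|exists b].
pose s := sup S.
have sb : s <= b by apply: ge_sup => //; exists a.
have as_ : a <= s by apply: ub_le_sup => //; exists b.
have [|e e0 He] := H s; first by rewrite as_ sb.
have [u [/andP[au ub] Pu] su] := sup_adherent e0 hS.
have us : u <= s by apply: ub_le_sup; [exists b|split => //; lra].
have [bs|bs] := lerP b (s + e / 2).
  by apply: (He u b) => //; lra.
have Pv : P (s + e / 2) by apply: (He u) => //; lra.
have : s + e / 2 <= s by apply: ub_le_sup; [exists b|split => //; lra].
lra.
Qed.

Lemma lebesgue_number (good : R -> R -> Prop) :
  (forall x, 0 <= x <= 1 -> exists2 e, 0 < e & forall u v,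
     0 <= u -> u <= v -> v <= 1 -> x - e < u -> v < x + e -> good u v) ->
  exists2 eta, 0 < eta & forall u v,
     0 <= u -> u <= v -> v <= 1 -> v - u <= eta -> good u v.
Proof.
move=> H.
apply: (@creep (fun x => exists2 eta, 0 < eta & forall u v,
     0 <= u -> u <= v -> v <= x -> v - u <= eta -> good u v) 0 1) => //.
  have [|e e0 He] := H 0; first by lra.
  by exists 1 => // u v u0 uv v0 _; apply: He => //; lra.
move=> x xI; have [e e0 He] := H x xI.
exists (e / 2); first by lra.
move=> u v u0 xu ux xv vx v1 [eta eta0 Heta].
(* An interval ending beyond [u > x - e / 2], of length at most [e / 2], begins after [x - e]. *)
exists (Num.min eta (e / 2)); first by rewrite lt_min; lra.
move=> p q p0 pq qv; rewrite le_min => /andP[l1 l2].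
have [qu|uq] := lerP q u; first exact: Heta.
by apply: He => //; lra.
Qed.

Lemma locally_lipschitz_le (F : R -> R) (L a b : R) : a <= b ->
  (forall x, a <= x <= b -> exists2 e, 0 < e & forall u, a <= u <= b ->
     x - e < u < x + e -> `|F u - F x| <= L * `|u - x|) ->
  `|F b - F a| <= L * (b - a).
Proof.
move=> ab H.
apply: (@creep (fun x => `|F x - F a| <= L * (x - a)) a b) => //.
  by rewrite !subrr normr0 mulr0.
move=> x xab; have [e e0 He] := H x xab.
exists e => // u v au xu ux xv vx vb Hu.
have := He u; have := He v.
rewrite (ger0_norm (_ : 0 <= v - x)); last lra.
rewrite (ler0_norm (_ : u - x <= 0)); last lra.
move=> H1 H2.
have {}H1 : `|F v - F x| <= L * (v - x) by apply: H1; lra.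
have {}H2 : `|F u - F x| <= L * (- (u - x)) by apply: H2; lra.
have := ler_normD (F v - F x) (F x - F a).
have := ler_normD (F x - F u) (F u - F a).
rewrite (distrC (F x)) (_ : F x - F u + (F u - F a) = F x - F a); last lra.
rewrite (_ : F v - F x + (F x - F a) = F v - F a); last lra.
lra.
Qed.

Lemma monotone_locally_constant (th : R -> R) a b : a <= b ->
  {homo th : x y / x <= y} ->
  (forall x, a <= x <= b -> exists2 e, 0 < e & th (x - e) = th (x + e)) ->
  th a = th b.
Proof.
move=> ab mth H.
apply: (@creep (fun x => th a = th x) a b) => // x xab.
have [e e0 He] := H x xab; exists e => // u v au xu ux xv vx vb ->.
apply/eqP; rewrite eq_le mth /=; last lra.
have h1 : th (x - e) <= th u by apply: mth; lra.
have h2 : th v <= th (x + e) by apply: mth; lra.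
lra.
Qed.

(* Distinct points of [0, 1] at distance at least d lie in distinct cells [i d, (i+1) d). *)
Lemma separated_size (d : R) (s : seq R) : 0 < d -> uniq s ->
  (forall x, x \in s -> 0 <= x <= 1) ->
  (forall x y, x \in s -> y \in s -> x != y -> d <= `|x - y|) ->
  (size s)%:R <= d^-1 + 1.
Proof.
move=> d0 us sI sd.
pose c x : nat := Num.truncn (x / d).
have cP x : x \in s -> (c x)%:R <= x / d < (c x).+1%:R.
  move=> xs; apply: truncn_itv.
  by rewrite divr_ge0 // ?(ltW d0) //; case/andP: (sI _ xs).
have cinj : {in s &, injective c}.
  move=> x y xs ys cxy; apply/eqP; apply: contraT => xy.
  have := sd _ _ xs ys xy; have /andP[] := cP _ xs; have /andP[] := cP _ ys.
  rewrite cxy -(@natr1 _ (c y)); set k := _%:R.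
  rewrite ler_pdivlMr // ltr_pdivrMr // ler_pdivlMr // ltr_pdivrMr //.
  rewrite !mulrDl mul1r => *; have : `|x - y| < d by rewrite ltr_norml; lra.
  lra.
have ucs : uniq (map c s) by rewrite map_inj_in_uniq.
pose M : nat := Num.truncn d^-1.
have sub : {subset map c s <= iota 0 M.+1}.
  move=> _ /mapP[x xs ->]; rewrite mem_iota /= add0n ltnS.
  apply: le_truncn; rewrite -[leRHS]mul1r ler_wpM2r ?invr_ge0 ?(ltW d0) //.
  by case/andP: (sI _ xs).
have := uniq_leq_size ucs sub; rewrite size_map size_iota => h.
rewrite (le_trans (_ : _ <= (M.+1)%:R)) ?ler_nat // -natr1 lerD2r.
have d1 : 0 <= d^-1 by rewrite invr_ge0 ltW.
by have /andP[] := truncn_itv d1.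
Qed.

End Creeping.

(** * Piecewise affine maps with slopes of a single absolute value *)

Section PiecewiseAffine.
Variable R : realType.
Implicit Types (F G : R -> R) (L M x y u v : R).

Lemma unitIE x : unitI R x = (0 <= x <= 1).
Proof. by rewrite /unitI /= in_itv. Qed.

Lemma within_continuous_eps F a b : {within `[a, b], continuous F} <->
  (forall x, a <= x <= b -> forall e, 0 < e -> exists2 d, 0 < d &
     forall y, a <= y <= b -> `|y - x| < d -> `|F y - F x| < e).
Proof.
split.
  move=> /subspace_continuousP H x xab e e0.
  have xA : `[a, b]%classic x by rewrite /= in_itv.
  have /cvgrPdist_lt /(_ _ e0) := H x xA.
  rewrite near_withinE => /nbhs_ballP[d /= d0 Hd].
  exists d => // y yab xy; rewrite distrC; apply: Hd; last by rewrite /= in_itv.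
  by rewrite /ball /= distrC.
move=> H; apply/subspace_continuousP => x; rewrite /= in_itv /= => xab.
apply/cvgrPdist_lt => e e0; rewrite near_withinE.
have [d d0 Hd] := H x xab e e0.
apply/nbhs_ballP; exists d => // y; rewrite /ball /= distrC => xy.
by rewrite in_itv /= => yab; rewrite distrC; apply: Hd.
Qed.

Lemma lipschitz_within F L a b :
  (forall x y, a <= x <= b -> a <= y <= b -> `|F x - F y| <= L * `|x - y|) ->
  {within `[a, b], continuous F}.
Proof.
move=> H; apply/within_continuous_eps => x xab e e0.
have L1 : 0 < `|L| + 1 by rewrite ltr_wpDl.
exists (e / (`|L| + 1)); first exact: divr_gt0.
move=> y yab; rewrite ltr_pdivlMr // => yx.
apply: (le_lt_trans (H _ _ yab xab)); apply: le_lt_trans yx.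
rewrite mulrC; apply: ler_wpM2l => //.
by rewrite (le_trans (ler_norm _)) // lerDl.
Qed.

Lemma within_IVT F a b y : a <= b -> {within `[a, b], continuous F} ->
  (F a <= y <= F b) || (F b <= y <= F a) -> exists2 z, a <= z <= b & F z = y.
Proof.
move=> ab cF H; have [] := @IVT R F a b y ab cF.
  by rewrite ge_min le_max; case/orP: H => /andP[-> ->]; rewrite ?orbT.
by move=> z; rewrite in_itv; exists z.
Qed.

(* Constant slope L, up to sign, on each side of every point: the derivative does
   not appear, so that the notion is stable under composition. *)
Definition piecewise_affine L F := forall x, 0 <= x <= 1 -> exists e s t,
  [/\ 0 < e, `|s| = L, `|t| = L,
      (forall u, 0 <= u <= 1 -> x <= u < x + e -> F u = F x + s * (u - x)) &
      (forall u, 0 <= u <= 1 -> x - e < u <= x -> F u = F x + t * (u - x))].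

(** Only points of [0, 1] are tested, so both endpoints are affine points of every piecewise affine
    map. For such a map with [L > 0], the points failing this are the interior turning points. *)
Definition affine_at L F x := exists e s, [/\ 0 < e, `|s| = L &
  forall u, 0 <= u <= 1 -> x - e < u < x + e -> F u = F x + s * (u - x)].

Definition stable01 F := forall x, 0 <= x <= 1 -> 0 <= F x <= 1.

Lemma iter_stable01 F n : stable01 F -> stable01 (iter n F).
Proof. by move=> sF; elim: n => //= n IH x xI; apply/sF/IH. Qed.

Lemma piecewise_affine_ge0 L F : piecewise_affine L F -> 0 <= L.
Proof. by move=> /(_ 0) [|e [s [t [_ <- _ _ _]]]] //; lra. Qed.

Lemma piecewise_affine_lipschitz L F u v : piecewise_affine L F ->
  0 <= u <= 1 -> 0 <= v <= 1 -> `|F u - F v| <= L * `|u - v|.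
Proof.
move=> pF; wlog vu : u v / v <= u => [H uI vI|uI vI].
  case: (leP v u) => [|/ltW] ?; first exact: H.
  by rewrite distrC (distrC u v); apply: H.
rewrite (ger0_norm (_ : 0 <= u - v)); last lra.
apply: locally_lipschitz_le => // x xuv.
have [|e [s [t [e0 sL tL Hs Ht]]]] := pF x; first lra.
exists e => // w wI xw; have [wx|xw'] := leP w x.
  by rewrite Ht; [rewrite addrC addKr normrM tL lexx|lra|lra].
by rewrite Hs; [rewrite addrC addKr normrM sL lexx|lra|lra].
Qed.

Lemma piecewise_affine_within L F a b : piecewise_affine L F ->
  0 <= a -> b <= 1 -> {within `[a, b], continuous F}.
Proof.
move=> pF a0 b1; apply: (@lipschitz_within F L) => x y xI yI.
by apply: piecewise_affine_lipschitz => //; lra.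
Qed.

Lemma piecewise_affine_comp L M F G : piecewise_affine L F ->
  piecewise_affine M G -> stable01 F -> piecewise_affine (L * M) (G \o F).
Proof.
move=> pF pG sF x xI.
have L0 := piecewise_affine_ge0 pF.
have [e1 [s1 [t1 [e10 s1L t1L Hs1 Ht1]]]] := pF x xI.
have [e2 [s2 [t2 [e20 s2M t2M Hs2 Ht2]]]] := pG _ (sF x xI).
(* The sign of the inner slope decides on which side of [F x] the image lies, and so which outer
   slope applies. *)
pose sl (r : R) := (if 0 <= r then s2 else t2) * r.
pose tl (r : R) := (if 0 <= r then t2 else s2) * r.
have L1 : 0 < L + 1 by lra.
exists (Num.min e1 (e2 / (L + 1))), (sl s1), (tl t1); split.
- by rewrite lt_min e10 divr_gt0.
- by rewrite /sl normrM mulrC s1L; case: ifP; rewrite ?s2M ?t2M.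
- by rewrite /tl normrM mulrC t1L; case: ifP; rewrite ?s2M ?t2M.
- move=> u uI /andP[xu]; rewrite -ltrBlDl lt_min ltr_pdivlMr // => /andP[u1 u2].
  have FI : 0 <= F x + s1 * (u - x) <= 1 by rewrite -Hs1; [exact: sF| |lra].
  have b1 : `|s1 * (u - x)| < e2.
    rewrite normrM s1L (ger0_norm (_ : 0 <= u - x)); last lra.
    by apply: le_lt_trans u2; rewrite mulrC ler_wpM2l; lra.
  move: b1; rewrite ltr_norml => b1; rewrite /sl /= Hs1 //; last lra.
  case: ifPn => s10.
    have : 0 <= s1 * (u - x) by rewrite mulr_ge0; lra.
    by move=> ?; rewrite Hs2 //; [ring|lra].
  have : s1 * (u - x) <= 0 by rewrite mulr_le0_ge0; lra.
  by move=> ?; rewrite Ht2 //; [ring|lra].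
move=> u uI /andP[]; rewrite ltrBlDl -ltrBlDr => xu ux.
move: xu; rewrite lt_min ltr_pdivlMr // => /andP[u1 u2].
have FI : 0 <= F x + t1 * (u - x) <= 1 by rewrite -Ht1; [exact: sF| |lra].
have b1 : `|t1 * (u - x)| < e2.
  rewrite normrM t1L (ler0_norm (_ : u - x <= 0)); last lra.
  by apply: le_lt_trans u2; rewrite mulrC opprB ler_wpM2l; lra.
move: b1; rewrite ltr_norml => b1; rewrite /tl /= Ht1 //; last lra.
case: ifPn => s10.
  have : t1 * (u - x) <= 0 by rewrite mulr_ge0_le0; lra.
  by move=> ?; rewrite Ht2 //; [ring|lra].
have : 0 <= t1 * (u - x) by rewrite mulr_le0; lra.
by move=> ?; rewrite Hs2 //; [ring|lra].
Qed.

Lemma piecewise_affine_id : piecewise_affine 1 (@id R).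
Proof.
move=> x xI; exists 1, 1, 1.
by rewrite normr1; split => // u _ _; rewrite /=; ring.
Qed.

Lemma piecewise_affine_iter L F n : stable01 F -> piecewise_affine L F ->
  piecewise_affine (L ^+ n) (iter n F).
Proof.
move=> sF pF; elim: n => [|n IH]; first exact: piecewise_affine_id.
rewrite exprSr; apply: (piecewise_affine_comp IH pF).
exact: iter_stable01.
Qed.

(** A Lebesgue number for the neighbourhoods in [piecewise_affine]: a short interval lies in one of
    them, whose only possible break is its centre. The point [c] is this centre, moved into the
    interval if necessary. *)
Lemma piecewise_affine_split L F : piecewise_affine L F ->
  exists2 eta, 0 < eta & forall u v,
    0 <= u -> u <= v -> v <= 1 -> v - u <= eta ->
    exists c, [/\ u <= c <= v,
      (forall a b, u <= a -> a <= b -> b <= c -> `|F b - F a| = L * (b - a)) &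
      (forall a b, c <= a -> a <= b -> b <= v -> `|F b - F a| = L * (b - a))].
Proof.
move=> pF; apply: lebesgue_number => x xI.
have [e [s [t [e0 sL tL Hs Ht]]]] := pF x xI.
exists e => // u v u0 uv v1 xu vx.
exists (Num.max u (Num.min v x)); split.
- by rewrite le_max lexx ge_max uv ge_min lexx.
- move=> a b ua ab; rewrite le_max le_min => /orP[bu|/andP[bv bx]].
    have -> : b = a by lra.
    by rewrite !subrr normr0 mulr0.
  rewrite Ht; [rewrite (Ht a)|lra|lra]; [|lra|lra].
  rewrite (_ : _ - _ = t * (b - a)); last ring.
  by rewrite normrM tL ger0_norm //; lra.
- move=> a b; rewrite ge_max ge_min => /andP[ua h] ab bv.
  have [xa|ax] := leP x a.
    rewrite Hs; [rewrite (Hs a)|lra|lra]; [|lra|lra].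
    rewrite (_ : _ - _ = s * (b - a)); last ring.
    by rewrite normrM sL ger0_norm //; lra.
  have va : v <= a by case/orP: h => //; lra.
  have -> : b = a by lra.
  by rewrite !subrr normr0 mulr0.
Qed.

End PiecewiseAffine.

(** * Constant slope maps are piecewise affine; expansion and crossings *)

Section ConstantSlope.
Variable R : realType.
Implicit Types (F G : R -> R) (l L a b x y u v : R).

Lemma finite_set_gap (A : set R) x : finite_set A ->
  exists2 e, 0 < e & forall y, A y -> y != x -> e <= `|y - x|.
Proof.
move=> /finite_seqP[s ->]; elim: s => [|z s [e e0 He]].
  by exists 1 => // y.
have [->|zx] := eqVneq z x.
  exists e => // y; rewrite /= inE => /orP[/eqP ->|ys yx]; first by rewrite eqxx.
  exact: He.
exists (Num.min e `|z - x|); first by rewrite lt_min e0 normr_gt0 subr_eq0.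
move=> y; rewrite /= inE => /orP[/eqP -> _|ys yx]; rewrite ge_min ?lexx ?orbT //.
by rewrite He.
Qed.

Lemma Crit_interior F x : 0 < x < 1 -> Crit F x ->
  ~ (exists2 U, nbhs x U & monotone_on (U `&` unitI R) F).
Proof. by move=> x01 [[/=|/=]|[]//] xE; move: x01; rewrite xE; lra. Qed.

Lemma constant_slope_isometric F l a b : {within unitI R, continuous F} ->
  has_constant_slope l F -> 0 <= a -> b <= 1 ->
  (forall x, a < x < b -> ~ Crit F x) ->
  forall u v, a <= u -> u <= v -> v <= b -> `|F v - F u| = l * (v - u).
Proof.
move=> cF sF a0 b1 nC u v au; rewrite le_eqVlt => /predU1P[->|uv] vb.
  by rewrite !subrr normr0 mulr0.
have [x xuv||c] := @MVT R F (derive1 F) u v uv.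
- move: xuv; rewrite in_itv /= => xuv.
  have [||dF _] := sF x; [by rewrite unitIE; lra|by apply: nC; lra|].
  by rewrite derive1E; apply: derivableP.
- apply: continuous_subspaceW cF => x; rewrite unitIE /= in_itv /=; lra.
rewrite in_itv /= => cuv ->.
have [||_ dF] := sF c; [by rewrite unitIE; lra|by apply: nC; lra|].
by rewrite normrM dF ger0_norm //; lra.
Qed.

(** Equality in the triangle inequality: the increments over [a, u] and [u, b] have absolute values
    adding up to that over [a, b], so they share its sign. *)
Lemma isometric_affine F l a b : a <= b -> 0 <= l ->
  (forall u v, a <= u -> u <= v -> v <= b -> `|F v - F u| = l * (v - u)) ->
  exists2 s, `|s| = l & forall u, a <= u <= b -> F u = F a + s * (u - a).
Proof.
move=> ab l0 H; have Hab := H a b (lexx _) ab (lexx _).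
have [F0|F0] := leP 0 (F b - F a).
  exists l => [|u /andP[au ub]]; first exact: ger0_norm.
  move: Hab; rewrite ger0_norm // => Hab.
  have h1 := H a u (lexx _) au ub; have h2 := H u b au ub (lexx _).
  have := ler_norm (F u - F a); have := ler_norm (F b - F u).
  rewrite h1 h2; lra.
exists (- l) => [|u /andP[au ub]]; first by rewrite normrN ger0_norm.
move: Hab; rewrite ltr0_norm // => Hab.
have h1 := H a u (lexx _) au ub; have h2 := H u b au ub (lexx _).
have := ler_norm (- (F u - F a)); have := ler_norm (- (F b - F u)).
rewrite !normrN h1 h2; lra.
Qed.

Lemma constant_slope_ge0 F l : finite_set (Crit F) -> has_constant_slope l F ->
  0 <= l.
Proof.
move=> fC sF; have [e e0 He] := finite_set_gap 0 fC.
pose x := Num.min (e / 2) (1 / 2).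
have x0 : 0 < x by rewrite lt_min; lra.
have xe : x <= e / 2 by rewrite ge_min lexx.
have x1 : x <= 1 / 2 by rewrite ge_min lexx orbT.
have [||_ <- //] := sF x; first by rewrite unitIE; lra.
move=> /He; rewrite subr0 gtr0_norm // gt_eqF // => /(_ isT); lra.
Qed.

Lemma constant_slope_piecewise_affine F l : {within unitI R, continuous F} ->
  finite_set (Crit F) -> has_constant_slope l F -> piecewise_affine l F.
Proof.
move=> cF fC sF x xI; have l0 := constant_slope_ge0 fC sF.
have [e e0 He] := finite_set_gap x fC.
have nC y : 0 < `|y - x| < e -> ~ Crit F y.
  move=> /andP[yx ye] /He; rewrite -subr_eq0 -normr_gt0 yx => /(_ isT); lra.
pose b := Num.min 1 (x + e / 2).
have [xb b1 be] : [/\ x <= b, b <= 1 & b <= x + e / 2].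
  by rewrite le_min !ge_min !lexx orbT; split => //; lra.
pose a := Num.max 0 (x - e / 2).
have [xa a0 ae] : [/\ a <= x, 0 <= a & x - e / 2 <= a].
  by rewrite ge_max !le_max !lexx orbT; split => //; lra.
have x0 : 0 <= x by lra.
have x1 : x <= 1 by lra.
have [|s sl Hs] := isometric_affine xb l0 (constant_slope_isometric cF sF x0 b1 _).
  by move=> y yxb; apply: nC; rewrite gtr0_norm; lra.
have [|t tl Ht] := isometric_affine xa l0 (constant_slope_isometric cF sF a0 x1 _).
  by move=> y yax; apply: nC; rewrite ltr0_norm; lra.
exists (e / 2), s, t; split => //; first by lra.
  by move=> u uI xu; rewrite Hs // le_min; lra.
have Hx : F x = F a + t * (x - a) by apply: Ht; lra.
by move=> u uI xu; rewrite Hx Ht; [ring|rewrite ge_max; lra].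
Qed.

Lemma affine_at_not_Crit L F x : affine_at L F x -> 0 < x < 1 -> ~ Crit F x.
Proof.
move=> [e [s [e0 _ Hs]]] x01 /(Crit_interior x01); apply.
exists (ball x e); first exact: nbhsx_ballx.
have FE y : (ball x e `&` unitI R) y -> F y = F x + s * (y - x).
  move=> [yx]; rewrite unitIE => yI; apply: Hs => //.
  by move: yx; rewrite /ball /= distrC ltr_norml; lra.
have [s0|s0] := leP 0 s; [left|right] => y z /FE -> /FE -> yz.
  by rewrite lerD2l ler_wpM2l //; lra.
by rewrite lerD2l ler_wnM2l //; lra.
Qed.

(** If [L <= 1], distances to a fixed point never grow, so a ball around it is never left, against
    transitivity. Radius 1/4 leaves points of [0, 1] outside the ball wherever the fixed point
    lies. *)
Lemma piecewise_affine_gt1 L F : piecewise_affine L F -> stable01 F ->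
  transitive_map F -> 1 < L.
Proof.
move=> pF sF tF; rewrite ltNge; apply/negP => L1.
have L0 := piecewise_affine_ge0 pF.
have [z zI Fz] : exists2 z, 0 <= z <= 1 & F z - z = 0.
  apply: within_IVT => //.
    apply: (@lipschitz_within R _ (L + 1)) => x y xI yI.
    have := piecewise_affine_lipschitz pF xI yI.
    have := ler_normB (F x - F y) (x - y).
    rewrite (_ : F x - F y - (x - y) = F x - x - (F y - y)); last ring.
    lra.
  by apply/orP; right; have := sF 0; have := sF 1; lra.
have stay n x : 0 <= x <= 1 -> `|iter n F x - z| <= `|x - z|.
  move=> xI; elim: n => //= n IH; apply: le_trans IH.
  have := piecewise_affine_lipschitz pF (iter_stable01 n sF xI) zI.
  rewrite (_ : F z = z); last lra.
  by move=> /le_trans; apply; rewrite ler_piMl.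
pose U : set R := ball z (1 / 4).
pose V : set R := [set y | y < z - 1 / 4] `|` [set y | z + 1 / 4 < y].
have [] := tF U V.
- exact: ball_open.
- by apply: openU; [exact: open_lt|exact: open_gt].
- by exists z; split; [apply: ballxx; lra|rewrite unitIE].
- have [z2|z2] := leP z (1 / 2).
    by exists 1; split; [right => /=; lra|rewrite unitIE; lra].
  by exists 0; split; [left => /=; lra|rewrite unitIE; lra].
move=> n [_ [[x [xz xI] <-] [xV _]]].
have := stay n x; rewrite unitIE in xI => /(_ xI).
move: xz; rewrite /U /ball /= distrC => xz h.
have : `|iter n F x - z| < 1 / 4 by lra.
by rewrite ltr_norml; case: xV => /= ?; lra.
Qed.

Lemma piecewise_affine_reflect L F :
  piecewise_affine L F -> piecewise_affine L (fun y => F (1 - y)).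
Proof.
move=> pF x xI; have [|e [s [t [e0 sL tL Hs Ht]]]] := pF (1 - x); first lra.
exists e, (- t), (- s); rewrite !normrN; split => // u uI xu.
  by rewrite Ht; [ring|lra|lra].
by rewrite Hs; [ring|lra|lra].
Qed.

(** At the supremum of the points where [F < x], smaller values just before force left slope [L],
    and values at least [x] just after force right slope [L]: this crossing avoids the turning
    points. *)
Lemma affine_crossing_lt L F a b x : piecewise_affine L F -> 0 < L ->
  0 <= a -> a < b -> b <= 1 -> F a < x < F b ->
  exists z, [/\ a < z < b, F z = x & affine_at L F z].
Proof.
move=> pF L0 a0 ab b1 Fab.
have lip u v : a <= u <= b -> a <= v <= b -> `|F u - F v| <= L * `|u - v|.
  by move=> uI vI; apply: piecewise_affine_lipschitz => //; lra.
pose S := [set z | a <= z <= b /\ F z < x].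
have ubS : ubound S b by move=> y [/andP[]].
have hS : has_sup S by split; [exists a; split; lra|exists b].
pose z := sup S.
have zS y : S y -> y <= z by move=> Sy; apply: ub_le_sup => //; exists b.
have zb : z <= b by apply: ge_sup => //; case: hS.
have az : a <= z by apply: zS; split; lra.
have Sz y : z < y <= b -> x <= F y.
  by move=> yzb; rewrite leNgt; apply/negP => Fy; have := zS y; rewrite /S /=; lra.
have Fz1 : F z <= x.
  rewrite leNgt; apply/negP => Fz.
  have e0 : 0 < (F z - x) / L by apply: divr_gt0 => //; lra.
  have [w [wab Fw] zw] := sup_adherent e0 hS; rewrite -/z in zw.
  have wz : w <= z by apply: zS.
  have : `|F z - F w| <= L * `|z - w| by apply: lip; lra.
  rewrite (ger0_norm (_ : 0 <= z - w)); last lra.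
  have : z - w < (F z - x) / L by lra.
  rewrite ltr_pdivlMr // => h1 h2; have := ler_norm (F z - F w); lra.
have zb' : z < b.
  by rewrite lt_neqAle zb andbT; apply/eqP => zE; rewrite zE in Fz1; lra.
have Fz : F z = x.
  apply/eqP; rewrite eq_le Fz1 /= leNgt; apply/negP => Fz.
  pose d := Num.min (b - z) ((x - F z) / (2 * L)).
  have d0 : 0 < d by rewrite lt_min subr_gt0 zb' divr_gt0 //; lra.
  have db : d <= b - z by rewrite ge_min lexx.
  have dF : d <= (x - F z) / (2 * L) by rewrite ge_min lexx orbT.
  have : x <= F (z + d) by apply: Sz; lra.
  have : `|F (z + d) - F z| <= L * `|z + d - z| by apply: lip; lra.
  rewrite (_ : z + d - z = d); last ring.
  rewrite (gtr0_norm d0); move: dF; rewrite ler_pdivlMr; last lra.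
  have := ler_norm (F (z + d) - F z); lra.
have az' : a < z.
  by rewrite lt_neqAle az andbT; apply/eqP => zE; rewrite -zE in Fz; lra.
exists z; split => //; first lra.
have [|e [s [t [e0 sL tL Hs Ht]]]] := pF z; first lra.
have [w [wab Fw] zw] := sup_adherent e0 hS; rewrite -/z in zw.
have wz : w <= z by apply: zS.
have wz' : w < z.
  by rewrite lt_neqAle wz andbT; apply/eqP => zE; rewrite zE in Fw; lra.
have tE : t = L.
  have h : F w = F z + t * (w - z) by apply: Ht; lra.
  have [t0|t0] := leP 0 t; first by rewrite -tL ger0_norm.
  have : 0 < t * (w - z) by rewrite nmulr_rgt0 //; lra.
  lra.
have sE : s = L.
  pose u := Num.min b (z + e / 2).
  have zu : z < u by rewrite lt_min; lra.
  have ub : u <= b by rewrite ge_min lexx.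
  have ue : u <= z + e / 2 by rewrite ge_min lexx orbT.
  have h : F u = F z + s * (u - z) by apply: Hs; lra.
  have Fu : x <= F u by apply: Sz; lra.
  have [s0|s0] := leP 0 s; first by rewrite -sL ger0_norm.
  have : s * (u - z) < 0 by rewrite nmulr_rlt0 //; lra.
  lra.
exists e, L; split => //; first by rewrite ger0_norm ?ltW.
move=> u uI zu; have [uz|uz] := leP u z.
  by rewrite Ht ?tE //; lra.
by rewrite Hs ?sE //; lra.
Qed.

Lemma affine_crossing L F a b x : piecewise_affine L F -> 0 < L ->
  0 <= a <= 1 -> 0 <= b <= 1 -> F a < x < F b ->
  exists z, [/\ (a < z < b) || (b < z < a), F z = x & affine_at L F z].
Proof.
move=> pF L0 aI bI Fx.
have [ab|ba|abE] := ltgtP a b; last by rewrite abE in Fx; lra.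
  have [||z [zab Fz az]] := affine_crossing_lt pF L0 _ ab _ Fx; [lra|lra|].
  by exists z; rewrite zab.
have [||||z [zab Fz [e [s [e0 sL Hs]]]]] :=
    affine_crossing_lt (a := 1 - a) (b := 1 - b) (x := x)
      (piecewise_affine_reflect pF) L0; try lra.
  by rewrite !subKr.
exists (1 - z); split => //; first by apply/orP; right; lra.
exists e, (- s); rewrite normrN; split => // u uI zu.
by have := Hs (1 - u); rewrite subKr => ->; [ring|lra|lra].
Qed.

End ConstantSlope.

(** * Distribution functions whose mass grows at most by [lam] under [F] *)

Section ExpandedDistribution.
Variables (R : realType) (F phi : R -> R) (lam : R).
Implicit Types (a b p q r u v x y eta rho : R).
Hypothesis lam1 : 1 < lam.
Hypothesis pF : piecewise_affine lam F.
Hypothesis sF : stable01 F.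
Hypothesis mphi : {homo phi : x y / x <= y}.
Hypothesis phi0 : forall x, x < 0 -> phi x = 0.
Hypothesis phi1 : forall x, 1 < x -> phi x = 1.
(** This form passes to limits: the strict inequalities persist for maps uniformly close to [F],
    while [phi] itself may jump at [F a] or [F b]. *)
Hypothesis phi_image : forall a b u v, 0 <= a <= 1 -> 0 <= b <= 1 ->
  F a < u -> u <= v -> v < F b -> phi v - phi u <= lam * `|phi b - phi a|.

Let lam0 : 0 < lam. Proof. exact: lt_trans ltr01 lam1. Qed.

Lemma distribution_itv x : 0 <= phi x <= 1.
Proof.
have [x0|x0] := leP 0 x; last by rewrite phi0 //; lra.
have [x1|x1] := leP x 1; last by rewrite phi1 //; lra.
have p0 : phi (-1) = 0 by apply: phi0; lra.
have p1 : phi 2 = 1 by apply: phi1; lra.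
have h0 : phi (-1) <= phi x by apply: mphi; lra.
have h1 : phi x <= phi 2 by apply: mphi; lra.
by lra.
Qed.

Lemma distribution_image_iter n a b u v : 0 <= a <= 1 -> 0 <= b <= 1 ->
  iter n F a < u -> u <= v -> v < iter n F b ->
  phi v - phi u <= lam ^+ n * `|phi b - phi a|.
Proof.
have l0 := lam0; have l1 := lam1.
elim: n a b u v => /= [|n IH] a b u v aI bI au uv vb.
  rewrite expr0 mul1r; have h1 : phi a <= phi u by apply: mphi; lra.
  have h2 : phi v <= phi b by apply: mphi; lra.
  by have := ler_norm (phi b - phi a); lra.
have [] : 0 <= iter n F a <= 1 /\ 0 <= iter n F b <= 1.
  by split; apply: iter_stable01.
set A := iter n F a in au *; set B := iter n F b in vb * => AI BI.
(* Moving [A] and [B] towards each other by at most [d] keeps [F A] below [u] and [F B] above [v],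
   which gives the induction hypothesis its strict inequalities; [d <= 1 / 4] keeps the two points
   from crossing. *)
have [d [d0 d1 dA dB]] : exists d, [/\ 0 < d, d <= 1 / 4,
    lam * d < u - F A & lam * d < F B - v].
  pose d := Num.min (1 / 4) (Num.min (u - F A) (F B - v) / (2 * lam)).
  have d1 : d <= Num.min (u - F A) (F B - v) / (2 * lam).
    by rewrite ge_min lexx orbT.
  have d0 : 0 < d.
    rewrite lt_min; apply/andP; split; first lra.
    by apply: divr_gt0; [rewrite lt_min !subr_gt0 au|lra].
  exists d; split => //; first by rewrite ge_min lexx.
    move: d1; rewrite ler_pdivlMr; last lra.
    by rewrite le_min => /andP[h _]; have := mulr_gt0 lam0 d0; lra.
  move: d1; rewrite ler_pdivlMr; last lra.
  by rewrite le_min => /andP[_ h]; have := mulr_gt0 lam0 d0; lra.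
pose p := A + d * (B - A); pose q := B + d * (A - B).
have AB : `|B - A| <= 1 by rewrite ler_norml; lra.
have AB' : `|A - B| <= 1 by rewrite distrC.
have dBA : `|d * (B - A)| <= d by rewrite normrM gtr0_norm // ler_piMr //; lra.
have dAB : `|d * (A - B)| <= d by rewrite normrM gtr0_norm // ler_piMr //; lra.
have AneB : A != B by apply/eqP => E; rewrite E in au; lra.
have convex : ((A < p /\ p <= q /\ q < B) \/ (B < q /\ q <= p /\ p < A)) /\
    0 <= p <= 1 /\ 0 <= q <= 1.
  have [AltB|BltA|E] := ltgtP A B; last by rewrite E eqxx in AneB.
    have h1 : 0 < d * (B - A) by rewrite mulr_gt0 ?subr_gt0.
    have h2 : d * (B - A) <= 1 / 4 * (B - A) by rewrite ler_wpM2r //; lra.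
    by rewrite /p /q (_ : d * (A - B) = - (d * (B - A))); [lra|ring].
  have h1 : 0 < d * (A - B) by rewrite mulr_gt0 ?subr_gt0.
  have h2 : d * (A - B) <= 1 / 4 * (A - B) by rewrite ler_wpM2r //; lra.
  by rewrite /p /q (_ : d * (B - A) = - (d * (A - B))); [lra|ring].
case: convex => pq [pI qI].
have Fp : F p < u.
  have := piecewise_affine_lipschitz pF pI AI.
  rewrite (_ : p - A = d * (B - A)); last by rewrite /p; ring.
  by have := ler_norm (F p - F A); have := ler_wpM2l (ltW lam0) dBA; lra.
have Fq : v < F q.
  have := piecewise_affine_lipschitz pF qI BI.
  rewrite (_ : q - B = d * (A - B)); last by rewrite /q; ring.
  have := ler_norm (- (F q - F B)); rewrite normrN.
  by have := ler_wpM2l (ltW lam0) dAB; lra.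
apply: le_trans (phi_image pI qI Fp uv Fq) _.
rewrite exprS -mulrA; apply: ler_wpM2l; first lra.
case: pq => [[Ap [pq qB]]|[Bq [qp pA]]].
  rewrite ger0_norm; first exact: IH.
  by rewrite subr_ge0 mphi.
rewrite distrC (distrC (phi b)) ger0_norm; first exact: IH.
by rewrite subr_ge0 mphi.
Qed.

(* A lower bound for the mean rate of phi at scale eta holds at all scales: an
   interval shorter than eta splits into two pieces expanded by L = lam ^+ N > 2, so the
   error term is multiplied by 2 / L each time the interval is replaced by its images. *)
Lemma distribution_lower_bound N eta rho : 2 < lam ^+ N -> 0 <= rho ->
  0 < eta ->
  (forall u v, 0 <= u -> u <= v -> v <= 1 -> v - u <= eta ->
    exists c, [/\ u <= c <= v,
      (forall a b, u <= a -> a <= b -> b <= c ->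
         `|iter N F b - iter N F a| = lam ^+ N * (b - a)) &
      (forall a b, c <= a -> a <= b -> b <= v ->
         `|iter N F b - iter N F a| = lam ^+ N * (b - a))]) ->
  (forall u v, 0 <= u -> v <= 1 -> eta <= v - u -> rho * (v - u) <= phi v - phi u) ->
  forall u v, 0 <= u -> u <= v -> v <= 1 -> rho * (v - u) <= phi v - phi u.
Proof.
move=> N2 rho0 eta0 Heta Hrho; set L := lam ^+ N in N2 Heta *.
have L0 : 0 < L by lra.
pose w k : R := (2 / L) ^+ k * eta.
have q0 : 0 <= 2 / L by apply: divr_ge0; lra.
have w0 k : 0 <= w k by apply: mulr_ge0; [exact: exprn_ge0|exact: ltW].
suff claim k u v : 0 <= u -> u <= v -> v <= 1 ->
    rho * (v - u - w k) <= phi v - phi u.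
  move=> u v u0 uv v1; apply/ler_addgt0Pr => e e0.
  have /cvgrPdist_lt /(_ (e / (rho * eta + 1))) H : (2 / L) ^+ n @[n --> \oo] --> (0 : R).
    by apply: cvg_expr; rewrite ger0_norm // ltr_pdivrMr //; lra.
  have re : 0 < rho * eta + 1 by rewrite ltr_wpDl // mulr_ge0 // ltW.
  have [|k _ /(_ k (leqnn _))] := H; first exact: divr_gt0.
  rewrite /= sub0r normrN (ger0_norm (_ : 0 <= (2 / L) ^+ k)); last exact: exprn_ge0.
  rewrite ltr_pdivlMr // => Hk; have := claim k u v u0 uv v1.
  have : 0 <= (2 / L) ^+ k by rewrite exprn_ge0.
  by move: Hk; rewrite /w; set x := (2 / L) ^+ k; lra.
elim: k u v => [|k IH] u v u0 uv v1.
  have [vu|uv'] := leP eta (v - u).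
    by apply: le_trans (Hrho u v u0 v1 vu); rewrite ler_wpM2l // /w; lra.
  apply: (@le_trans _ _ 0); last by rewrite subr_ge0 mphi.
  by rewrite mulr_ge0_le0 // /w expr0 mul1r; lra.
have [vu|/ltW uv'] := leP eta (v - u).
  apply: le_trans (Hrho u v u0 v1 vu); rewrite ler_wpM2l //.
  by have := w0 k.+1; lra.
have piece a c : 0 <= a -> a <= c -> c <= 1 ->
    `|iter N F c - iter N F a| = L * (c - a) ->
    rho * (L * (c - a) - w k) <= L * (phi c - phi a).
  move=> a0 ac c1 iso.
  have aI : 0 <= a <= 1 by lra.
  have cI : 0 <= c <= 1 by lra.
  have AI := iter_stable01 N sF aI; have CI := iter_stable01 N sF cI.
  have phiac : 0 <= phi c - phi a by rewrite subr_ge0 mphi.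
  have [lo [hi [loI hiI lohi Hlo]]] : exists lo hi,
      [/\ 0 <= lo <= 1, 0 <= hi <= 1, hi - lo = L * (c - a) &
      forall x y, lo < x -> x <= y -> y < hi ->
        phi y - phi x <= L * (phi c - phi a)].
    have [AC|CA] := leP (iter N F a) (iter N F c).
      exists (iter N F a), (iter N F c); split => //.
        by rewrite -iso ger0_norm // subr_ge0.
      move=> x y ax xy yc; rewrite -[phi c - phi a]ger0_norm //.
      exact: distribution_image_iter.
    exists (iter N F c), (iter N F a); split => //.
      by rewrite -iso ltr0_norm ?opprB // subr_lt0.
    move=> x y ax xy yc; rewrite -[phi c - phi a]ger0_norm // distrC.
    exact: distribution_image_iter.
  rewrite -lohi; have [lh|lh] := leP hi lo.
    apply: (@le_trans _ _ 0); last by rewrite mulr_ge0 // ltW.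
    by rewrite mulr_ge0_le0 //; have := w0 k; lra.
  apply/ler_addgt0Pr => e e0.
  (* The mass bound covers only the open image, so both ends are trimmed by [d], at a cost of
     [2 * rho * d <= e]. *)
  pose d := Num.min ((hi - lo) / 2) (e / (2 * rho + 1)).
  have d0 : 0 < d by rewrite lt_min !divr_gt0 //; lra.
  have d1 : d <= (hi - lo) / 2 by rewrite ge_min lexx.
  have d2 : d <= e / (2 * rho + 1) by rewrite ge_min lexx orbT.
  move: d2; rewrite ler_pdivlMr; last lra.
  have : phi (hi - d) - phi (lo + d) <= L * (phi c - phi a) by apply: Hlo; lra.
  have : rho * (hi - d - (lo + d) - w k) <= phi (hi - d) - phi (lo + d).
    by apply: IH; lra.
  by clear -d0 rho0; lra.
have [c [/andP[uc cv] Hl Hr]] := Heta u v u0 uv v1 uv'.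
have c1 : c <= 1 by lra.
have c0 : 0 <= c by lra.
have h1 := piece u c u0 uc c1 (Hl u c (lexx _) uc (lexx _)).
have h2 := piece c v c0 cv v1 (Hr c v (lexx _) cv (lexx _)).
rewrite -(ler_pM2l L0) (_ : w k.+1 = 2 / L * w k); last by rewrite /w exprS mulrA.
rewrite (_ : L * _ = rho * (L * (v - u) - 2 * w k)); last by field; lra.
by clear -h1 h2; lra.
Qed.

End ExpandedDistribution.

(** * Growth of intervals under iteration *)

Section Spreading.
Variable R : realType.
Implicit Types (F : R -> R) (lam a b p q u v x y eta : R).

Lemma expr_gt lam M : 1 < lam -> exists N, M < lam ^+ N.
Proof.
move=> l1; have l0 : 0 < lam by lra.
have M1 : 0 < `|M| + 1 by rewrite ltr_wpDl.
have /cvgrPdist_lt /(_ (`|M| + 1)^-1) H : lam^-1 ^+ n @[n --> \oo] --> (0 : R).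
  by apply: cvg_expr; rewrite ger0_norm ?invr_ge0 ?(ltW l0) // invf_lt1.
have [|N _ /(_ N (leqnn _))] := H; first by rewrite invr_gt0.
rewrite /= sub0r normrN ger0_norm; last by rewrite exprn_ge0 // invr_ge0 ltW.
rewrite exprVn ltf_pV2 ?posrE ?exprn_gt0 // => hN; exists N.
by have := ler_norm M; lra.
Qed.

(** The threshold 2 compensates the splitting: the longer of the two pieces has at least half the
    length, so its image is longer than the original interval. *)
Lemma expanding_iterate F lam : 1 < lam -> stable01 F -> piecewise_affine lam F ->
  exists N eta, [/\ 2 < lam ^+ N, 0 < eta, eta <= 1 & forall u v,
    0 <= u -> u <= v -> v <= 1 -> v - u <= eta ->
    exists c, [/\ u <= c <= v,
      (forall a b, u <= a -> a <= b -> b <= c ->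
         `|iter N F b - iter N F a| = lam ^+ N * (b - a)) &
      (forall a b, c <= a -> a <= b -> b <= v ->
         `|iter N F b - iter N F a| = lam ^+ N * (b - a))]].
Proof.
move=> l1 sF pF; have [N N2] := expr_gt 2 l1.
have [eta eta0 H] := piecewise_affine_split (piecewise_affine_iter N sF pF).
exists N, (Num.min eta 1); split => //.
- by rewrite lt_min eta0 ltr01.
- by rewrite ge_min lexx orbT.
- by move=> u v u0 uv v1; rewrite le_min => /andP[h _]; exact: H.
Qed.

Lemma iter_IVT F lam n p q a b y : stable01 F -> piecewise_affine lam F ->
  0 <= p -> q <= 1 -> p <= a <= q -> p <= b <= q ->
  iter n F a <= y <= iter n F b -> exists2 z, p <= z <= q & iter n F z = y.
Proof.
move=> sF pF p0 q1 apq bpq yab.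
have pn := piecewise_affine_iter n sF pF.
have [ab|/ltW ba] := leP a b.
  have [||z zab <-] := @within_IVT R (iter n F) a b y ab.
  - by apply: (piecewise_affine_within pn); lra.
  - by rewrite yab.
  by exists z => //; lra.
have [||z zab <-] := @within_IVT R (iter n F) b a y ba.
- by apply: (piecewise_affine_within pn); lra.
- by rewrite yab orbT.
by exists z => //; lra.
Qed.

(** At the times [j * N] the image of [p, q] contains an interval of length [l]: one of its two
    pieces has length at least [l / 2] and is stretched by more than 2. At other times, going on to
    a later multiple of [N] shows a loss of at most a factor [lam ^+ N]. *)
Lemma iterates_spread F lam p q : 1 < lam -> stable01 F -> piecewise_affine lam F ->
  0 <= p -> p < q -> q <= 1 ->
  exists2 d, 0 < d & forall k, exists a b,
    [/\ p <= a <= q, p <= b <= q & d <= `|iter k F a - iter k F b|].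
Proof.
move=> l1 sF pF p0 pq q1.
have [N [eta [N2 eta0 eta1 H]]] := expanding_iterate l1 sF pF.
pose l := Num.min (q - p) eta.
have l0 : 0 < l by rewrite lt_min subr_gt0 pq.
have leta : l <= eta by rewrite ge_min lexx orbT.
have claim j : exists a b,
    [/\ p <= a <= q, p <= b <= q & l <= iter (j * N) F b - iter (j * N) F a].
  elim: j => [|j [a [b [apq bpq]]]].
    by exists p, q; split; rewrite /= ?ge_min; lra.
  set A := iter _ F a; set B := iter _ F b => AB.
  have AI : 0 <= A <= 1 by apply: iter_stable01 => //; lra.
  have BI : 0 <= B <= 1 by apply: iter_stable01 => //; lra.
  have [||||c [/andP[uc cv] Hl Hr]] := H A (A + l); try lra.
  have [u [v [Au uv vB huv]]] : exists u v, [/\ A <= u, u <= v, v <= B &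
      l <= `|iter N F v - iter N F u|].
    have Nl : l <= lam ^+ N * (l / 2).
      by rewrite mulrCA ler_peMr ?(ltW l0) // ler_pdivlMr //; lra.
    have [cl|cl] := leP (l / 2) (c - A).
      exists A, c; split => //; first lra.
      by rewrite Hl // (le_trans Nl) // ler_wpM2l //; lra.
    exists c, (A + l); split => //; first lra.
    by rewrite Hr // (le_trans Nl) // ler_wpM2l //; lra.
  have [|a' a'pq Ea] := @iter_IVT F lam (j * N) p q a b u sF pF p0 q1 apq bpq.
    by rewrite -/A -/B; lra.
  have [|b' b'pq Eb] := @iter_IVT F lam (j * N) p q a b v sF pF p0 q1 apq bpq.
    by rewrite -/A -/B; lra.
  move: huv; rewrite -Ea -Eb -!iterD -mulSn.
  have [h|/ltW h] := leP (iter (j.+1 * N) F a') (iter (j.+1 * N) F b').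
    by rewrite ger0_norm ?subr_ge0 //; exists a', b'.
  by rewrite distrC ger0_norm ?subr_ge0 //; exists b', a'.
have L0 : 0 < lam ^+ N by lra.
exists (l / lam ^+ N); first exact: divr_gt0.
move=> k; have N0 : (0 < N)%N by case: (N) N2 => //; rewrite expr0; lra.
have [a [b [apq bpq hab]]] := claim (k %/ N).+1.
exists a, b; split => //; rewrite ler_pdivrMr //.
set m := ((k %/ N).+1 * N)%N in hab.
have km : (k <= m)%N by rewrite ltnW // ltn_ceil.
have mk : (m - k <= N)%N.
  by rewrite leq_subLR /m mulSn addnC leq_add2r leq_trunc_div.
have pm := piecewise_affine_iter (m - k) sF pF.
have aI : 0 <= iter k F a <= 1 by apply: iter_stable01 => //; lra.
have bI : 0 <= iter k F b <= 1 by apply: iter_stable01 => //; lra.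
have := piecewise_affine_lipschitz pm bI aI.
rewrite -!iterD subnK // distrC => h.
apply: (le_trans hab); apply: (le_trans (ler_norm _)).
rewrite distrC; apply: (le_trans h); rewrite mulrC distrC ler_wpM2l //.
by apply: ler_weXn2l => //; lra.
Qed.

Lemma positive_minimum (f : nat -> R) K : (forall i, (i < K)%N -> 0 < f i) ->
  exists2 d, 0 < d & forall i, (i < K)%N -> d <= f i.
Proof.
elim: K => [|K IH] H; first by exists 1.
have [|d d0 Hd] := IH; first by move=> i iK; apply: H; rewrite ltnW.
exists (Num.min d (f K)); first by rewrite lt_min d0 H.
move=> i; rewrite ltnS leq_eqVlt ge_min => /predU1P[->|/Hd ->] //.
by rewrite lexx orbT.
Qed.

End Spreading.

(** * The optimal linear lower bound and the support of the excess *)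

Section ConformalDistribution.
Variables (R : realType) (F phi : R -> R) (lam : R).
Implicit Types (a b p q r u v x y eta rho : R).
Hypothesis lam1 : 1 < lam.
Hypothesis pF : piecewise_affine lam F.
Hypothesis sF : stable01 F.
Hypothesis mphi : {homo phi : x y / x <= y}.
Hypothesis phi0 : forall x, x < 0 -> phi x = 0.
Hypothesis phi1 : forall x, 1 < x -> phi x = 1.
Hypothesis phi_image : forall a b u v, 0 <= a <= 1 -> 0 <= b <= 1 ->
  F a < u -> u <= v -> v < F b -> phi v - phi u <= lam * `|phi b - phi a|.

(** [r] is the supremum of the rates valid at scales at least [eta], and [distribution_lower_bound]
    extends it to all scales. Without a tight interval, the finitely many cells of a grid would all
    have excess at least some [d > 0], and [r + d] would still be valid at scale [eta]. *)
Lemma distribution_rate : exists r, [/\ 0 <= r,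
  (forall u v, 0 <= u -> u <= v -> v <= 1 -> r * (v - u) <= phi v - phi u) &
  exists p q, [/\ 0 <= p, p < q, q <= 1 & phi q - phi p = r * (q - p)]].
Proof.
have [N [eta [N2 eta0 eta1 Heta]]] := expanding_iterate lam1 sF pF.
pose A := [set rho | 0 <= rho /\ forall u v, 0 <= u -> v <= 1 ->
  eta <= v - u -> rho * (v - u) <= phi v - phi u].
have AB rho u v : A rho -> 0 <= u -> v <= 1 -> eta <= v - u ->
    rho <= (phi v - phi u) / (v - u).
  by move=> [_ H] u0 v1 uv; rewrite ler_pdivlMr; [exact: H|lra].
have A0 : A 0.
  split=> // u v u0 v1 uv; rewrite mul0r subr_ge0; apply: mphi; lra.
have ubA : ubound A (phi 1 - phi 0).
  move=> rho Ar; have := AB rho 0 1 Ar; rewrite subr0 divr1; apply => //; lra.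
have hA : has_sup A by split; [exists 0|exists (phi 1 - phi 0)].
pose r := sup A.
have r0 : 0 <= r by apply: ub_le_sup => //; exists (phi 1 - phi 0).
have Ar : A r.
  split => // u v u0 v1 uv; rewrite -ler_pdivlMr; last lra.
  by apply: ge_sup; [exists 0|move=> rho Arho; exact: AB].
have low := distribution_lower_bound lam1 pF sF mphi phi_image N2 r0 eta0 Heta Ar.2.
exists r; split => //.
apply: contrapT => noK.
pose th x := phi x - r * x.
(* With this mesh, every interval of length at least [eta] in [0, 1] contains a whole cell. *)
pose h := eta / 3.
have h0 : 0 < h by rewrite /h; lra.
pose K : nat := Num.truncn h^-1.
have hi0 : 0 <= h^-1 by rewrite invr_ge0 ltW.
have Kh i : (i < K)%N -> i.+1%:R * h <= 1.
  move=> iK; rewrite -ler_pdivlMr // mul1r.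
  have /andP[+ _] := truncn_itv hi0; apply: le_trans.
  by rewrite ler_nat.
have [|d d0 Hd] := @positive_minimum R (fun i => th (i.+1%:R * h) - th (i%:R * h)) K.
  move=> i iK /=; have ih : 0 <= i%:R * h by rewrite mulr_ge0 // ltW.
  have := Kh i iK; rewrite -natr1 mulrDl mul1r => ih1.
  have := low (i%:R * h) (i%:R * h + h) ih _ ih1.
  rewrite (_ : i%:R * h + h - i%:R * h = h); last ring.
  move=> lowh; have {lowh} : r * h <= phi (i%:R * h + h) - phi (i%:R * h).
    by apply: lowh; lra.
  rewrite le_eqVlt => /predU1P[E|]; last by rewrite /th; lra.
  exfalso; apply: noK; exists (i%:R * h), (i%:R * h + h); split => //; first lra.
  by rewrite -E; congr (_ * _); ring.
have Ard : A (r + d).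
  split=> [|u v u0 v1 uv]; first lra.
  pose i : nat := (Num.truncn (u / h)).+1.
  have uh0 : 0 <= u / h by rewrite divr_ge0 // ltW.
  have /andP[hi1 hi2] := truncn_itv uh0.
  have hi2' : u < i%:R * h by rewrite -ltr_pdivrMr.
  have hi1' : i.+1%:R * h <= u + 2 * h.
    move: hi1; rewrite ler_pdivlMr // /i -!natr1; lra.
  have uv3 : u + 2 * h <= v by rewrite /h; lra.
  have iK : (i < K)%N.
    rewrite /K truncn_ge_nat // -[leRHS]mul1r ler_pdivlMr //; lra.
  have := Hd i iK.
  have := low u (i%:R * h) u0 (ltW hi2') _.
  have := low (i.+1%:R * h) v _ _ v1.
  have i0 : 0 <= i.+1%:R * h by rewrite mulr_ge0 // ltW.
  have ii : i.+1%:R * h = i%:R * h + h by rewrite -natr1 mulrDl mul1r.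
  move=> /(_ i0) H1 H2; have {}H1 := H1 _; have {}H2 := H2 _.
  have {H1} : r * (v - i.+1%:R * h) <= phi v - phi (i.+1%:R * h) by apply: H1; lra.
  have {H2} : r * (i%:R * h - u) <= phi (i%:R * h) - phi u by apply: H2; lra.
  have : d * (v - u) <= d by rewrite ler_piMr ?(ltW d0) //; lra.
  by rewrite /th; lra.
have : r + d <= r by apply: ub_le_sup => //; exists (phi 1 - phi 0).
by lra.
Qed.

Section Defect.
Variables r p q : R.
Hypothesis r0 : 0 <= r.
Hypothesis low : forall u v, 0 <= u -> u <= v -> v <= 1 -> r * (v - u) <= phi v - phi u.
Hypotheses (p0 : 0 <= p) (pq : p < q) (q1 : q <= 1).
Hypothesis tight : phi q - phi p = r * (q - p).

Let l0 : 0 < lam. Proof. exact: lt_trans ltr01 lam1. Qed.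

Definition clamp01 y : R := if y < 0 then 0 else if 1 < y then 1 else y.

Lemma clamp01_itv y : 0 <= clamp01 y <= 1.
Proof. by rewrite /clamp01; case: ltP => ?; try case: ltP => ?; lra. Qed.

Lemma clamp01_id y : 0 <= y <= 1 -> clamp01 y = y.
Proof. by rewrite /clamp01; case: ltP => ?; try case: ltP => ?; lra. Qed.

Lemma clamp01_lt0 y : y < 0 -> clamp01 y = 0.
Proof. by rewrite /clamp01 => ->. Qed.

Lemma clamp01_gt1 y : 1 < y -> clamp01 y = 1.
Proof. by rewrite /clamp01; case: ltP => ?; try case: ltP => ?; lra. Qed.

Lemma clamp01_diff y z : y <= z -> 0 <= clamp01 z - clamp01 y <= z - y.
Proof.
by rewrite /clamp01; do 4?[case: ltP => ?]; lra.
Qed.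

(** Distribution function of the excess of the measure of [phi] over [r] times Lebesgue measure. The
    clamp makes it constant beyond the endpoints, so that atoms at 0 and 1 are treated like all
    others. *)
Definition defect y := phi y - r * clamp01 y.

(** As [defect] is nondecreasing, this says that [y] lies off the support of the excess measure. *)
Definition flat y := exists2 e, 0 < e & defect (y - e) = defect (y + e).

Lemma defect_homo : {homo defect : y z / y <= z}.
Proof.
move=> y z yz; rewrite /defect.
have [z0|z0] := ltP z 0.
  by rewrite !clamp01_lt0 ?phi0 //; lra.
have [y1|y1] := ltP 1 y.
  by rewrite !clamp01_gt1 ?phi1 //; lra.
have h : r * (clamp01 z - clamp01 y) <= phi (clamp01 z) - phi (clamp01 y).
  have := clamp01_itv y; have := clamp01_itv z; have := clamp01_diff yz.
  by move=> *; apply: low; lra.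
have hy : phi y <= phi (clamp01 y).
  apply: mphi; have [y0|y0] := ltP y 0; first by rewrite clamp01_lt0 ?ltW.
  by rewrite clamp01_id //; lra.
have hz : phi (clamp01 z) <= phi z.
  apply: mphi; have [z1|z1] := ltP 1 z; first by rewrite clamp01_gt1 ?ltW.
  by rewrite clamp01_id //; lra.
by lra.
Qed.

Lemma flat_sub a b y : defect a = defect b -> a < y < b -> flat y.
Proof.
move=> ab yab; exists (Num.min (y - a) (b - y)); first by rewrite lt_min; lra.
set e := Num.min _ _.
have e1 : e <= y - a by rewrite ge_min lexx.
have e2 : e <= b - y by rewrite ge_min lexx orbT.
have e0 : 0 < e by rewrite lt_min; lra.
have h1 : defect a <= defect (y - e) by apply: defect_homo; lra.
have h2 : defect (y - e) <= defect (y + e) by apply: defect_homo; lra.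
have h3 : defect (y + e) <= defect b by apply: defect_homo; lra.
by lra.
Qed.

Lemma flat_tight y : p < y < q -> flat y.
Proof.
have := p0; have := q1; have := pq; have := tight => *.
by apply: (@flat_sub p q); rewrite // /defect !clamp01_id //; lra.
Qed.

Lemma flat_outside y : ~~ (0 <= y <= 1) -> flat y.
Proof.
rewrite negb_and -!ltNge => /orP[y0|y1].
  by apply: (@flat_sub (y - 1) (y / 2)); rewrite /defect ?phi0 ?clamp01_lt0 //; lra.
apply: (@flat_sub ((y + 1) / 2) (y + 1)); last lra.
by rewrite /defect !clamp01_gt1 ?phi1 //; lra.
Qed.

(** Around [y] the mass is [r] times the length. By [phi_image] it grows at most by [lam], just as
    the length does, so the image has at most [r] times its length, the least that [low] permits. *)
Lemma flat_image y : 0 < y < 1 -> affine_at lam F y -> flat y -> flat (F y).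
Proof.
move=> yI [e1 [s [e10 sL Hs]]] [e e0 He].
have l0' := l0; have r0' := r0.
pose d := Num.min (Num.min e (e1 / 2)) (Num.min y (1 - y)).
have [d0 de de1 dy dy1] : [/\ 0 < d, d <= e, d <= e1 / 2, d <= y & d <= 1 - y].
  by rewrite /d !lt_min !ge_min !lexx !orbT; split => //; lra.
(* Half of the available radius [lam * d]: the radius [f + h] with [h <= f], widened to get strict
   inequalities, still has preimages within [d] of [y]. *)
pose f := lam * d / 2.
have f0 : 0 < f by rewrite /f divr_gt0 ?mulr_gt0.
have s0 : s != 0 by rewrite -normr_gt0 sL.
have near g : 0 <= g <= 2 * f -> `|g / s| <= d.
  move=> g0; rewrite normrM normfV sL ger0_norm ?ler_pdivrMr //; last lra.
  by rewrite /f in g0; lra.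
have Fnear g : 0 <= g <= 2 * f ->
    [/\ 0 <= y - g / s <= 1, 0 <= y + g / s <= 1,
       F (y - g / s) = F y - g & F (y + g / s) = F y + g].
  move=> /near; rewrite ler_norml => gs; split; try lra.
    by rewrite Hs; [field|lra|lra].
  by rewrite Hs; [field|lra|lra].
have [|a1 b1 Fa1 Fb1] := Fnear (2 * f); first lra.
have := sF a1; have := sF b1; rewrite Fa1 Fb1 => Fb Fa.
exists f => //; apply/eqP; rewrite eq_le defect_homo /=; last lra.
apply/ler_addgt0Pr => g g0.
pose h := Num.min f (g / (2 * r + 1)).
have h0 : 0 < h by rewrite lt_min f0 divr_gt0 //; lra.
have hf : h <= f by rewrite ge_min lexx.
have hg : h * (2 * r + 1) <= g by rewrite -ler_pdivlMr; [rewrite ge_min lexx orbT|lra].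
have [|a2 b2 Fa2 Fb2] := Fnear (f + h); first lra.
have n2 : `|(f + h) / s| <= d by apply: near; lra.
have n3 : lam * `|2 * ((f + h) / s)| = 2 * (f + h).
  rewrite !normrM normfV sL !ger0_norm //; last lra.
  by field; rewrite gt_eqF.
set k := (f + h) / s in a2 b2 Fa2 Fb2 n2 n3.
have h1 : phi (F y + f) - phi (F y - f) <= lam * `|phi (y + k) - phi (y - k)|.
  apply: phi_image => //; [rewrite Fa2|lra|rewrite Fb2];
  by lra.
have flat2 : `|phi (y + k) - phi (y - k)| = r * `|2 * k|.
  have n2' := n2; rewrite ler_norml in n2'.
  have E z : y - e <= z -> z <= y + e -> defect z = defect (y + e).
    move=> z1 z2; apply/eqP; rewrite eq_le defect_homo //=.
    by rewrite -He defect_homo.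
  have : defect (y + k) = defect (y - k).
    by rewrite !E //; lra.
  rewrite /defect !clamp01_id // => E2.
  rewrite (_ : phi _ - phi _ = r * (2 * k)); last by lra.
  by rewrite normrM ger0_norm.
rewrite flat2 mulrCA n3 in h1.
rewrite /defect !clamp01_id; [|by lra|by lra].
by lra.
Qed.

(** By [affine_crossing], each value strictly inside the image is attained at an affine point, so
    flatness travels from (p, q) without meeting a turning point. *)
Lemma flat_iter k x a b : p <= a <= q -> p <= b <= q ->
  iter k F a < x < iter k F b -> flat x.
Proof.
have := p0; have := q1 => q1' p0'.
elim: k a b x => /= [|k IH] a b x apq bpq xab; first by apply: flat_tight; lra.
have AI : 0 <= iter k F a <= 1 by apply: iter_stable01 => //; lra.
have BI : 0 <= iter k F b <= 1 by apply: iter_stable01 => //; lra.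
have [z [zab <- az]] := affine_crossing pF l0 AI BI xab.
apply: flat_image => //; first by case/orP: zab; lra.
by case/orP: zab; [exact: IH|exact: IH].
Qed.

End Defect.
End ConformalDistribution.

(** * Lebesgue measure is the only possible limit *)

Section ConformalUniqueness.
Variables (R : realType) (F phi : R -> R) (lam : R).
Implicit Types (a b c d e p q r t u v x y z : R).
Hypothesis lam1 : 1 < lam.
Hypothesis pF : piecewise_affine lam F.
Hypothesis sF : stable01 F.
Hypothesis mphi : {homo phi : x y / x <= y}.
Hypothesis phi0 : forall x, x < 0 -> phi x = 0.
Hypothesis phi1 : forall x, 1 < x -> phi x = 1.
Hypothesis phi_image : forall a b u v, 0 <= a <= 1 -> 0 <= b <= 1 ->
  F a < u -> u <= v -> v < F b -> phi v - phi u <= lam * `|phi b - phi a|.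
(* phi is multiplied exactly by lam near the points where F is affine; all that is
   needed beyond phi_image is this statement on atoms, which includes endpoints. *)
Hypothesis phi_atom : forall x e, 0 <= x <= 1 -> affine_at lam F x -> 0 < e ->
  exists2 d, 0 < d & lam * (phi (x + d) - phi (x - d)) <= phi (F x + e) - phi (F x - e).
Hypothesis tF : transitive_map F.

Let l0 : 0 < lam. Proof. exact: lt_trans ltr01 lam1. Qed.

(** If [F] took values only weakly on one side of [x], orbits starting strictly on that side would
    never reach the other. *)
Lemma transitive_onto x : 0 < x < 1 ->
  exists a b, [/\ 0 <= a <= 1, 0 <= b <= 1 & F a < x < F b].
Proof.
move=> x01.
have [a aI Fa] : exists2 a, 0 <= a <= 1 & F a < x.
  apply: contrapT => H.
  have [||n [_ [[y [xy yI] <-] [/= yx _]]]] :=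
    tF (U := [set y | x < y]) (V := [set y | y < x]) (@open_gt _ _) (@open_lt _ _).
  - by exists 1; split; [rewrite /=|rewrite unitIE]; lra.
  - by exists 0; split; [rewrite /=|rewrite unitIE]; lra.
  case: n yx => [|n] /= yx; first by move: xy => /=; lra.
  by apply: H; exists (iter n F y) => //; apply: iter_stable01; rewrite -?unitIE.
have [b bI Fb] : exists2 b, 0 <= b <= 1 & x < F b.
  apply: contrapT => H.
  have [||n [_ [[y [xy yI] <-] [/= yx _]]]] :=
    tF (U := [set y | y < x]) (V := [set y | x < y]) (@open_lt _ _) (@open_gt _ _).
  - by exists 0; split; [rewrite /=|rewrite unitIE]; lra.
  - by exists 1; split; [rewrite /=|rewrite unitIE]; lra.
  case: n yx => [|n] /= yx; first by move: xy => /=; lra.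
  by apply: H; exists (iter n F y) => //; apply: iter_stable01; rewrite -?unitIE.
by exists a, b; split => //; lra.
Qed.

Lemma affine_at_endpoint x : x = 0 \/ x = 1 -> affine_at lam F x.
Proof.
move=> x01; have [|e [s [t [e0 sL tL Hs Ht]]]] := pF (x := x); first by case: x01; lra.
case: x01 => xE; [exists e, s|exists e, t]; split => // u uI xu.
  by apply: Hs => //; lra.
by apply: Ht => //; lra.
Qed.

(* The mass of an atom is multiplied by lam along the orbit. *)
Lemma no_persistent_atom x t : 0 <= x <= 1 -> 0 < t ->
  (forall x t, 0 <= x <= 1 -> 0 < t ->
    (forall e, 0 < e -> t <= phi (x + e) - phi (x - e)) -> affine_at lam F x) ->
  ~ (forall e, 0 < e -> t <= phi (x + e) - phi (x - e)).
Proof.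
move=> xI t0 aff H.
have lamn n : 0 < lam ^+ n by rewrite exprn_gt0.
have claim n e : 0 < e ->
    lam ^+ n * t <= phi (iter n F x + e) - phi (iter n F x - e).
  elim: n e => [|n IH] e e0; first by rewrite expr0 mul1r; exact: H.
  have yI := iter_stable01 n sF xI.
  have [|d d0] := phi_atom yI _ e0.
    by apply: aff yI _ IH; rewrite mulr_gt0.
  by rewrite exprS -mulrA; apply: le_trans; rewrite ler_pM2l // IH.
have [n] := expr_gt t^-1 lam1; rewrite -[_^-1]mul1r ltr_pdivrMr // => hn.
have := claim n 1 ltr01.
have := distribution_itv mphi phi0 phi1 (iter n F x + 1).
have := distribution_itv mphi phi0 phi1 (iter n F x - 1).
lra.
Qed.

Theorem conformal_distribution_id x : 0 <= x <= 1 -> phi x = x.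
Proof.
have [r [r0 low [p [q [p0 pq q1 tight]]]]] :=
  distribution_rate lam1 pF sF mphi phi_image.
have l0' := l0; have l1 := lam1.
pose Z y := flat phi r y; pose th y := defect phi r y.
have mth : {homo th : y z / y <= z} := defect_homo mphi phi0 phi1 low.
have Zsub a b y : th a = th b -> a < y < b -> Z y := @flat_sub R phi mphi phi0 phi1 r low a b y.
have Zout y : ~~ (0 <= y <= 1) -> Z y := @flat_outside R phi mphi phi0 phi1 r low y.
have Zim y : 0 < y < 1 -> affine_at lam F y -> Z y -> Z (F y).
  exact: (flat_image lam1 sF mphi phi0 phi1 phi_image r0 low).
have Zit k y a b : p <= a <= q -> p <= b <= q -> iter k F a < y < iter k F b -> Z y.
  exact: (flat_iter lam1 pF sF mphi phi0 phi1 phi_image r0 low p0 pq q1 tight).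
have [d d0 Hd] := iterates_spread lam1 sF pF p0 pq q1.
(* Transitivity puts some point of an image of (p, q) between [y] and [z]. If the image of [p, q]
   went past [y] or [z], that point would be flat by [flat_iter]; so the image, of spread at least
   [d], stays in [y, z]. *)
have gap y z : ~ Z y -> ~ Z z -> y < z -> d <= z - y.
  move=> nZy nZz yz; rewrite leNgt; apply/negP => zyd.
  have yI : 0 <= y <= 1 by apply/negP => /negP /Zout.
  have zI : 0 <= z <= 1 by apply/negP => /negP /Zout.
  have [|||| n [_ [[w [/= wpq wI] <-] [/= wyz _]]]] :=
    tF (U := `]p, q[%classic) (V := `]y, z[%classic).
  - exact: interval_open.
  - exact: interval_open.
  - by exists ((p + q) / 2); split; [rewrite /= in_itv /=|rewrite unitIE]; lra.
  - by exists ((y + z) / 2); split; [rewrite /= in_itv /=|rewrite unitIE]; lra.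
  move: wpq wyz; rewrite !in_itv /= => wpq wyz.
  have wpq' : p <= w <= q by lra.
  have [a [b [apq bpq hab]]] := Hd n.
  have out c : p <= c <= q -> y <= iter n F c <= z.
    move=> cpq; apply/andP; split; rewrite leNgt; apply/negP => h.
      by apply: nZy; apply: (Zit n y c w) => //; lra.
    by apply: nZz; apply: (Zit n z w c) => //; lra.
  have := out a apq; have := out b bpq.
  have : `|iter n F a - iter n F b| <= z - y.
    by rewrite ler_norml; have := out a apq; have := out b bpq; lra.
  by lra.
(* A turning point outside Z would have an infinite backward orbit outside Z;
   as the complement of Z is finite, this orbit is a cycle of affine points. *)
have aff c : 0 < c < 1 -> ~ Z c -> affine_at lam F c.
  move=> cI nZc.
  have /boolp.choice[pre Hpre] y : exists z, 0 < y < 1 -> ~ Z y ->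
      [/\ 0 < z < 1, ~ Z z, affine_at lam F z & F z = y].
    have [[yI nZy]|H] := pselect (0 < y < 1 /\ ~ Z y); last first.
      by exists 0 => yI nZy; case: H.
    have [a [b [aI bI Fab]]] := transitive_onto yI.
    have [z [zab Fz az]] := affine_crossing pF l0 aI bI Fab.
    have zI : 0 < z < 1 by case/orP: zab; lra.
    exists z => _ _; split => // Zz; apply: nZy; rewrite -Fz; exact: Zim.
  pose o n := iter n pre c.
  have oI n : 0 < o n < 1 /\ ~ Z (o n).
    elim: n => [|n [IH1 IH2]]; first by split.
    by have [] := Hpre _ IH1 IH2.
  have oF n : F (o n.+1) = o n /\ affine_at lam F (o n.+1).
    by have [h1 h2] := oI n; have [] := Hpre _ h1 h2.
  have oiter i j : iter i F (o (i + j)%N) = o j.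
    elim: i j => // i IH j; rewrite iterS.
    by rewrite addSnnS IH; case: (oF j).
  have [//|naff] := pselect (affine_at lam F c).
  (* Applying [F] [i] times to a repetition [o i = o j] exhibits [c] as a chosen preimage, hence as
     an affine point. *)
  have ne i j : (i < j)%N -> o i <> o j.
    move=> ij E; apply: naff.
    have h1 := oiter i 0; have h2 := oiter i (j - i)%N.
    rewrite addn0 E in h1; rewrite subnKC ?(ltnW ij) // h1 in h2.
    rewrite (_ : c = o 0) // h2.
    by have := (oF (j - i).-1).2; rewrite prednK // subn_gt0.
  have oinj : injective o.
    by move=> i j E; case: (ltngtP i j) => // h; [case: (ne _ _ h)|case: (ne _ _ h)].
  pose s := map o (iota 0 (Num.truncn (d^-1 + 1)).+1).
  have := @separated_size R d s d0; rewrite map_inj_uniq ?iota_uniq //.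
  move=> /(_ isT); rewrite size_map size_iota => h.
  have d10 : 0 <= d^-1 + 1 by rewrite addr_ge0 // invr_ge0 ltW.
  have /andP[_] := truncn_itv d10; rewrite ltNge => /negP; case; apply: h.
    by move=> _ /mapP[i _ ->]; have [] := oI i; lra.
  move=> _ _ /mapP[i _ ->] /mapP[j _ ->] ij.
  have [[_ nZi] [_ nZj]] := (oI i, oI j).
  have [h|h|E] := ltgtP (o i) (o j); last by rewrite E eqxx in ij.
    by rewrite ler0_norm ?opprB; [exact: gap|lra].
  by rewrite ger0_norm; [exact: gap|lra].
have atom_aff y t : 0 <= y <= 1 -> 0 < t ->
    (forall e, 0 < e -> t <= phi (y + e) - phi (y - e)) -> affine_at lam F y.
  move=> yI t0 Ht.
  have [y0|y0] := eqVneq y 0; first by apply: affine_at_endpoint; left.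
  have [y1|y1] := eqVneq y 1; first by apply: affine_at_endpoint; right.
  apply: aff; first by case/andP: yI => h0 h1; rewrite !lt_neqAle y1 eq_sym y0 h0 h1.
  move=> [e e0 He].
  (* On a flat neighbourhood [phi] would grow by at most [2 * r * g < t]; so an atom is never flat,
     and [aff] applies. *)
  pose g := Num.min e (t / (4 * r + 1)).
  have g0 : 0 < g by rewrite lt_min e0 divr_gt0 //; lra.
  have ge : g <= e by rewrite ge_min lexx.
  have gt : g * (4 * r + 1) <= t.
    by rewrite -ler_pdivlMr; [rewrite ge_min lexx orbT|lra].
  have h1 : th (y + g) <= th (y + e) by apply: mth; lra.
  have h2 : th (y - e) <= th (y - g) by apply: mth; lra.
  have yg : y - g <= y + g by lra.
  have /andP[_ h3] := clamp01_diff yg.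
  have := ler_wpM2l r0 h3; have := Ht g g0; move: h1 h2; rewrite /th -He /defect.
  by lra.
(* By [gap], a point that is not flat is isolated among such points, so the excess [t] around it
   sits in one atom, which [no_persistent_atom] excludes. *)
have allZ y : Z y.
  apply: contrapT => nZy.
  have yI : 0 <= y <= 1 by apply/negP => /negP /Zout.
  pose t := th (y + d / 2) - th (y - d / 2).
  have t0 : 0 < t.
    rewrite subr_gt0 lt_neqAle mth ?andbT; last lra.
    by apply/eqP => E; apply: nZy; exists (d / 2) => //; lra.
  apply: (@no_persistent_atom y t yI t0 atom_aff) => e e0.
  have h : t <= th (y + e) - th (y - e).
    have [de|ed] := leP (d / 2) e.
      have h1 : th (y + d / 2) <= th (y + e) by apply: mth; lra.
      have h2 : th (y - e) <= th (y - d / 2) by apply: mth; lra.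
      by rewrite /t; lra.
    have h1 : th (y + e) = th (y + d / 2).
      apply: monotone_locally_constant => // [|z zy]; first lra.
      have [//|nZz] := pselect (Z z).
      by have := gap _ _ nZy nZz; lra.
    have h2 : th (y - d / 2) = th (y - e).
      apply: monotone_locally_constant => // [|z zy]; first lra.
      have [//|nZz] := pselect (Z z).
      by have := gap _ _ nZz nZy; lra.
    by rewrite /t h1 h2.
  have ye : y - e <= y + e by lra.
  have /andP[h3 _] := clamp01_diff ye.
  by have := mulr_ge0 r0 h3; move: h; rewrite /th /defect; lra.
move=> xI.
have const a b : a <= b -> th a = th b.
  by move=> ab; apply: monotone_locally_constant => // y _; exact: allZ.
(* Comparing -1 with 2 gives [0 = 1 - r]; comparing -1 with [x] then gives [phi x = x]. *)
have m1 : ((-1 : R) < 0) by lra.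
have h1 := const (-1) 2 _; have h2 := const (-1) x _.
have {}h1 : th (-1) = th 2 by apply: h1; lra.
have {}h2 : th (-1) = th x by apply: h2; lra.
move: h1 h2; rewrite /th /defect (clamp01_lt0 m1) phi0 // clamp01_gt1; last lra.
rewrite clamp01_id // phi1; last lra.
move=> h1 h2; have r1 : r = 1 by lra.
by rewrite r1 in h2; lra.
Qed.

End ConformalUniqueness.

(** * Counting separated sets of piecewise affine maps *)

Section BowenBalls.
Variable R : realType.
Implicit Types (F G : R -> R) (L lam x y u v eta eps : R) (D s : seq R).

Lemma seq_extrema x D : x \in D -> exists u v,
  [/\ u \in D, v \in D & forall y, y \in D -> u <= y <= v].
Proof.
move=> xD; have [u uD Hu] : exists2 u, u \in D & forall y, y \in D -> u <= y.
  elim: D x xD => // z D IH x _; case: D IH => [|w D] IH.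
    by exists z; rewrite ?mem_head // => y; rewrite inE => /eqP ->.
  have [u uD Hu] := IH w (mem_head _ _).
  have [zu|uz] := leP z u.
    exists z; rewrite ?mem_head // => y; rewrite inE => /predU1P[->//|/Hu].
    exact: le_trans.
  exists u; first by rewrite inE uD orbT.
  by move=> y; rewrite inE => /predU1P[->|/Hu//]; exact: ltW.
have [v vD Hv] : exists2 v, v \in D & forall y, y \in D -> y <= v.
  elim: D x xD {u uD Hu} => // z D IH x _; case: D IH => [|w D] IH.
    by exists z; rewrite ?mem_head // => y; rewrite inE => /eqP ->.
  have [u uD Hu] := IH w (mem_head _ _).
  have [uz|zu] := leP u z.
    exists z; rewrite ?mem_head // => y; rewrite inE => /predU1P[->//|/Hu yu].
    exact: le_trans yu uz.
  exists u; first by rewrite inE uD orbT.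
  by move=> y; rewrite inE => /predU1P[->|/Hu//]; exact: ltW.
by exists u, v; split => // y yD; rewrite Hu // Hv.
Qed.

(* A Bowen ball of length j is covered by 2^j intervals on which the j-th iterate
   is affine of slope L^j, hence it meets a sufficiently sparse set in at most 2^j points. *)
Lemma bowen_ball_size G L eta j D : 0 < L -> stable01 G ->
  (forall u v, 0 <= u -> u <= v -> v <= 1 -> v - u <= eta ->
    exists c, [/\ u <= c <= v,
      (forall a b, u <= a -> a <= b -> b <= c -> `|G b - G a| = L * (b - a)) &
      (forall a b, c <= a -> a <= b -> b <= v -> `|G b - G a| = L * (b - a))]) ->
  uniq D -> (forall x, x \in D -> 0 <= x <= 1) ->
  (forall x y i, x \in D -> y \in D -> (i <= j)%N ->
     `|iter i G x - iter i G y| <= eta) ->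
  (forall x y, x \in D -> y \in D -> x != y -> eta < L ^+ j * `|x - y|) ->
  (size D <= 2 ^ j)%N.
Proof.
move=> L0 sG HG; elim: j D => [|j IH] D uD DI Dc Ds.
  case: D uD DI Dc Ds => [|x [|y D]] //= /andP[+ _] _ Dc Ds.
  rewrite inE negb_or => /andP[xy _].
  have xD : x \in [:: x, y & D] by rewrite mem_head.
  have yD : y \in [:: x, y & D] by rewrite !inE eqxx orbT.
  by have := Ds x y xD yD xy; rewrite expr0 mul1r ltNge (Dc x y 0%N).
have [->//|/eqP D0] := eqVneq D [::].
have [x xD] : exists x, x \in D.
  by case: D D0 {uD DI Dc Ds} => // z D _; exists z; rewrite mem_head.
have [u [v [uinD vinD Huv]]] := seq_extrema xD.
have uv : u <= v by case/andP: (Huv x xD); exact: le_trans.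
have [||||c [ucv Hl Hr]] := HG u v; rewrite //.
- by case/andP: (DI u uinD).
- by case/andP: (DI v vinD).
- have := Dc v u 0%N vinD uinD isT; rewrite ger0_norm // subr_ge0 //.
(* On one side of [c], [G] multiplies distances by [L], so the image points satisfy the same
   hypotheses with [j] iterates left. *)
have half D' : uniq D' -> {subset D' <= D} ->
    (forall a b, a \in D' -> b \in D' -> a <= b -> `|G b - G a| = L * (b - a)) ->
    (size D' <= 2 ^ j)%N.
  move=> uD' sD' iso.
  have iso' a b : a \in D' -> b \in D' -> `|G a - G b| = L * `|a - b|.
    move=> aD bD; have [ab|/ltW ba] := leP a b.
      by rewrite distrC iso // (distrC a) (ger0_norm (_ : 0 <= b - a)) ?subr_ge0.
    by rewrite iso // (ger0_norm (_ : 0 <= a - b)) ?subr_ge0.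
  rewrite -(size_map G); apply: IH.
  - rewrite map_inj_in_uniq // => a b aD bD E.
    have := iso' a b aD bD; rewrite E subrr normr0 => /esym/eqP.
    by rewrite mulf_eq0 gt_eqF //= normr_eq0 subr_eq0 => /eqP.
  - by move=> _ /mapP[a aD ->]; apply: sG; apply: DI; exact: sD'.
  - move=> _ _ i /mapP[a aD ->] /mapP[b bD ->] ij; rewrite -!iterSr.
    by apply: Dc; rewrite ?ltnS //; exact: sD'.
  - move=> _ _ /mapP[a aD ->] /mapP[b bD ->] ab; rewrite iso' // mulrA -exprSr.
    by apply: Ds; [exact: sD'|exact: sD'|apply: contraNneq ab => ->].
rewrite -(count_predC [pred y | y <= c] D) -!size_filter expnS mul2n -addnn.
apply: leq_add; apply: half; rewrite ?filter_uniq //.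
- by move=> y; rewrite mem_filter => /andP[].
- move=> a b; rewrite !mem_filter /= => /andP[ac aD] /andP[bc bD] ab.
  by apply: Hl => //; case/andP: (Huv a aD).
- by move=> y; rewrite mem_filter => /andP[].
- move=> a b; rewrite !mem_filter /= -!ltNge => /andP[ac aD] /andP[bc bD] ab.
  by apply: Hr => //; [exact: ltW|case/andP: (Huv b bD)].
Qed.

Definition bowen_close F n eps x y :=
  all (fun k => `|iter k F x - iter k F y| <= eps) (iota 0 n).

(** Each chosen point discards its Bowen ball, hence at most [M] points of [D]. *)
Lemma greedy_separated F n eps M D : 0 <= eps -> uniq D ->
  (forall x, x \in D -> 0 <= x <= 1) ->
  (forall x, x \in D -> (count (bowen_close F n eps x) D <= M)%N) ->
  exists s, [/\ dyn_separated F n eps s, {subset s <= D} &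
    (size D <= M * size s)%N].
Proof.
move=> eps0; have [k] := ubnP (size D); elim: k D => // k IH D Dk uD DI Dc.
case: D uD DI Dc Dk => [|x D'] uD DI Dc Dk; first by exists [::].
set D := x :: D' in uD DI Dc Dk *.
have xD : x \in D by rewrite mem_head.
have xx : bowen_close F n eps x x.
  by apply/allP => i _; rewrite subrr normr0.
pose E := [seq y <- D | predC (bowen_close F n eps x) y].
have ED : {subset E <= D} by move=> y; rewrite mem_filter => /andP[].
have sE : (count (bowen_close F n eps x) D + size E = size D)%N.
  by rewrite size_filter count_predC.
have c1 : (0 < count (bowen_close F n eps x) D)%N.
  by rewrite -has_count; apply/hasP; exists x.
have [|||| s [[us sI ssep] sE' hs]] := IH E.
- rewrite ltnS in Dk; apply: leq_trans Dk; apply: leq_trans (eq_leq sE).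
  by rewrite -add1n leq_add2r.
- exact: filter_uniq.
- by move=> y /ED /DI.
- move=> y yE; apply: leq_trans (Dc y (ED _ yE)).
  by apply: leq_count_subseq; exact: filter_subseq.
exists (x :: s); split; first split.
- rewrite /= us andbT; apply/negP => /sE'.
  by rewrite mem_filter /= xx.
- by move=> y; rewrite inE unitIE => /predU1P[->|/sI]; [exact: DI|rewrite unitIE].
- have far y : y \in s -> exists2 i : nat, (i < n)%N & eps < `|iter i F x - iter i F y|.
    move=> /sE'; rewrite mem_filter => /andP[/allPn[i]].
    by rewrite mem_iota /= add0n -ltNge => ? ?; exists i.
  move=> y z; rewrite !inE => /predU1P[->|ys] /predU1P[->|zs] yz.
  + by rewrite eqxx in yz.
  + exact: far.
  + by have [i ? ?] := far y ys; exists i; rewrite // distrC.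
  + exact: ssep.
- by move=> y; rewrite inE => /predU1P[->//|/sE' /ED].
- rewrite [size (x :: s)]/= mulnS; apply: (leq_trans (eq_leq (esym sE))).
  by apply: leq_add; rewrite ?Dc.
Qed.

(** A grid of spacing [2 * eta / L ^+ j] has about [L ^+ j / (2 * eta)] points, at most [2 ^ j] in
    each Bowen ball. The radius [eta / 2] keeps two points of a ball within [eta] of each other, and
    the length [(j * N).+1] includes the time [j * N]. *)
Lemma separated_growth F lam N : 1 < lam -> stable01 F -> piecewise_affine lam F ->
  2 < lam ^+ N -> exists eps c, [/\ 0 < eps, 0 < c & forall j, exists2 s,
    dyn_separated F (j * N).+1 eps s & c * (lam ^+ N / 2) ^+ j <= (size s)%:R].
Proof.
move=> l1 sF pF N2; set L := lam ^+ N in N2 *.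
have [eta eta0 H] := piecewise_affine_split (piecewise_affine_iter N sF pF).
have L0 : 0 < L by lra.
exists (eta / 2), (eta^-1 / 2); split; rewrite ?divr_gt0 ?invr_gt0 // => j.
have Lj : 0 < L ^+ j by rewrite exprn_gt0.
pose w := 2 * eta / L ^+ j.
have w0 : 0 < w by rewrite /w divr_gt0 ?mulr_gt0.
have w1 : 0 <= w^-1 by rewrite invr_ge0 ltW.
have /andP[K1 K2] := truncn_itv w1.
pose D := [seq i%:R * w | i <- iota 0 (Num.truncn w^-1).+1].
have DI x : x \in D -> 0 <= x <= 1.
  move=> /mapP[i]; rewrite mem_iota /= add0n ltnS => iK ->.
  rewrite mulr_ge0 ?(ltW w0) //= -ler_pdivlMr // mul1r.
  by apply: le_trans K1; rewrite ler_nat.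
have Dsep x y : x \in D -> y \in D -> x != y -> eta < L ^+ j * `|x - y|.
  move=> /mapP[i _ ->] /mapP[i' _ ->] ii'.
  have ne : (i != i') by apply: contraNneq ii' => ->.
  rewrite -mulrBl normrM (gtr0_norm w0) mulrCA.
  rewrite (_ : L ^+ j * w = 2 * eta); last by rewrite /w mulrC divfK // gt_eqF.
  have : 1 <= `|i%:R - i'%:R : R|.
    wlog ii : i i' {ii'} ne / (i < i')%N.
      move=> W; have [h|h|E] := ltngtP i i'; [exact: W| |by rewrite E eqxx in ne].
      by rewrite distrC; apply: W; rewrite // eq_sym.
    rewrite distrC -natrB ?(ltnW ii) // ger0_norm // -[leLHS]/(1%:R) ler_nat.
    by rewrite subn_gt0.
  move=> h; have : 2 * eta <= `|i%:R - i'%:R| * (2 * eta) by rewrite ler_peMl //; lra.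
  by lra.
have uD : uniq D.
  rewrite map_inj_uniq ?iota_uniq // => i i' /(mulIf (lt0r_neq0 w0)).
  by move=> /eqP; rewrite eqr_nat => /eqP.
have [||s [sep _ hs]] := @greedy_separated F (j * N).+1 (eta / 2) (2 ^ j) D _ uD DI.
- by rewrite divr_ge0 // ltW.
- move=> x xD; rewrite -size_filter.
  apply: (@bowen_ball_size (iter N F) L eta) => //.
  + exact: iter_stable01.
  + exact: filter_uniq.
  + by move=> y; rewrite mem_filter => /andP[_ /DI].
  + move=> y z i; rewrite !mem_filter => /andP[/allP yc _] /andP[/allP zc _] ij.
    rewrite -!iterM.
    have iN : (i * N)%N \in iota 0 (j * N).+1.
      by rewrite mem_iota /= add0n ltnS leq_mul2r ij orbT.
    have := yc _ iN; have := zc _ iN; rewrite /=.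
    set A := iter _ F x; set B := iter _ F y; set C := iter _ F z => h1 h2.
    have := ler_normB (A - C) (A - B).
    by rewrite (_ : A - C - (A - B) = B - C); [lra|ring].
  + by move=> y z; rewrite !mem_filter => /andP[_ yD] /andP[_ zD]; exact: Dsep.
exists s => //.
have : (size D)%:R <= (2 ^ j * size s)%:R :> R by rewrite ler_nat.
rewrite size_map size_iota natrM natrX => hD.
have h2 : (0 : R) < 2 ^+ j by rewrite exprn_gt0.
rewrite expr_div_n (_ : _ / 2 * _ = w^-1 / 2 ^+ j); last first.
  rewrite /w; move: (L ^+ j) (2 ^+ j) Lj h2 => x y x0 y0.
  by field; rewrite !gt_eqF.
rewrite ler_pdivrMr // [leRHS]mulrC; apply: le_trans hD; exact: ltW K2.
Qed.

(** By the Lipschitz bound, points separated by [eps] before time [n] start at distance at least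
    [eps / lam ^+ n]. *)
Lemma separated_size_le F lam n eps s : 1 < lam -> stable01 F ->
  piecewise_affine lam F -> 0 < eps -> dyn_separated F n eps s ->
  (size s)%:R <= (eps^-1 + 1) * lam ^+ n.
Proof.
move=> l1 sF pF eps0 [us sI ss].
have ln1 : 1 <= lam ^+ n by rewrite exprn_ege1 // ltW.
have ln0 : 0 < lam ^+ n by lra.
have := @separated_size R (eps / lam ^+ n) s; rewrite divr_gt0 // us.
move=> /(_ isT isT) h; have {}h : (size s)%:R <= (eps / lam ^+ n)^-1 + 1.
  apply: h => [x /sI|x y xs ys xy]; first by rewrite unitIE.
  have [k kn hk] := ss x y xs ys xy.
  have xI : 0 <= x <= 1 by rewrite -unitIE; exact: sI.
  have yI : 0 <= y <= 1 by rewrite -unitIE; exact: sI.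
  have := piecewise_affine_lipschitz (piecewise_affine_iter k sF pF) xI yI.
  rewrite ler_pdivrMr // => hl.
  apply: (le_trans (ltW hk)); apply: (le_trans hl).
  by rewrite mulrC ler_wpM2l //; apply: ler_weXn2l; [exact: ltW|exact: ltnW].
apply: (le_trans h); rewrite invf_div mulrDl mul1r [lam ^+ n / eps]mulrC.
by rewrite lerD2l.
Qed.

End BowenBalls.

(** * Entropy equals the logarithm of the slope *)

Section EntropyOfSlope.
Variable R : realType.
Implicit Types (F : R -> R) (lam x y eps B : R) (s : seq R) (a b : nat -> \bar R).

Lemma limn_esup_ge a (l : \bar R) :
  (forall n0, exists2 n, (n0 <= n)%N & (l <= a n)%E) -> (l <= limn_esup a)%E.
Proof.
move=> H; apply: le_ereal_inf_tmp => _ [V [n0 _ Vn0] <-].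
have [n n0n ln] := H n0; apply: le_ereal_sup_tmp.
by exists (a n) => //; exists n => //; exact: Vn0.
Qed.

Lemma limn_esup_le a (l : \bar R) n0 :
  (forall n, (n0 <= n)%N -> (a n <= l)%E) -> (limn_esup a <= l)%E.
Proof.
move=> H; apply: ge_ereal_inf.
exists (ereal_sup [set a n | n in [set n | (n0 <= n)%N]]).
  by exists [set n | (n0 <= n)%N] => //; exists n0.
by apply: ge_ereal_sup => _ [n n0n <-]; exact: H.
Qed.

Lemma le_limn_esup a b : (forall n, (a n <= b n)%E) -> (limn_esup a <= limn_esup b)%E.
Proof.
move=> H; apply: le_ereal_inf_tmp => _ [V HV <-]; apply: ge_ereal_inf.
exists (ereal_sup [set a n | n in V]); first by exists V.
apply: ge_ereal_sup => _ [n Vn <-]; apply: le_ereal_sup_tmp.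
by exists (b n) => //; exists n.
Qed.

Lemma lne_le (x y : \bar R) : (0 <= x)%E -> (x <= y)%E -> (lne x <= lne y)%E.
Proof.
move=> x0 xy; have mem (z : \bar R) : (0 <= z)%E -> z \in `[0%E, +oo%E].
  by move=> z0; rewrite in_itv /= z0 leey.
by rewrite lee_lne //; apply: mem => //; exact: le_trans xy.
Qed.

Lemma max_separated_ge0 F n eps : (0 <= max_separated F n eps)%E.
Proof.
by apply: le_ereal_sup_tmp; exists 0%:E => //; exists [::]; split.
Qed.

Lemma lne_max_separated_le F n eps B : 0 < B ->
  (forall s, dyn_separated F n eps s -> (size s)%:R <= B) ->
  (lne (max_separated F n eps) <= (ln B)%:E)%E.
Proof.
move=> B0 H; rewrite -lne_EFin //; apply: lne_le; first exact: max_separated_ge0.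
by apply: ge_ereal_sup => _ [s Hs <-]; rewrite lee_fin; exact: H.
Qed.

Lemma lne_max_separated_ge F n eps B s : 0 < B ->
  dyn_separated F n eps s -> B <= (size s)%:R ->
  ((ln B)%:E <= lne (max_separated F n eps))%E.
Proof.
move=> B0 Hs Bs; rewrite -lne_EFin //; apply: lne_le; first by rewrite lee_fin ltW.
by apply: le_ereal_sup_tmp; exists (size s)%:R%:E; rewrite ?lee_fin //; exists s.
Qed.

Lemma nat_gt x : exists n : nat, x < n%:R.
Proof.
exists (Num.truncn `|x|).+1; have /andP[_] := truncn_itv (normr_ge0 x).
by apply: le_lt_trans; exact: ler_norm.
Qed.

Theorem top_entropy_piecewise_affine F lam : 1 < lam -> stable01 F ->
  piecewise_affine lam F -> top_entropy F = (ln lam)%:E.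
Proof.
move=> l1 sF pF; have l0 : 0 < lam by lra.
apply/eqP; rewrite eq_le; apply/andP; split.
  apply: ge_ereal_sup => h [eps /=]; rewrite in_itv /= andbT => eps0 <-.
  apply/lee_addgt0Pr => d d0; rewrite -EFinD.
  pose C := eps^-1 + 1; have C0 : 0 < C by rewrite addr_gt0 ?invr_gt0.
  have [n0 Hn0] := nat_gt (ln C / d).
  apply: (limn_esup_le (n0 := n0.+1)) => n n0n.
  have n1 : 0 < n%:R :> R by rewrite ltr0n (leq_trans _ n0n).
  have ln0 : 0 < lam ^+ n by rewrite exprn_gt0.
  apply: (@le_trans _ _ ((n%:R^-1)%:E * (ln (C * lam ^+ n))%:E)%E).
    apply: lee_wpmul2l; first by rewrite lee_fin invr_ge0 ltW.
    apply: lne_max_separated_le => [|s]; first exact: mulr_gt0.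
    exact: separated_size_le.
  rewrite -EFinM lee_fin mulrC ler_pdivrMr // lnM ?posrE // lnXn // -mulr_natr.
  have : n0%:R <= n%:R :> R by rewrite ler_nat ltnW.
  move: Hn0; rewrite ltr_pdivrMr // => h1 h2.
  by have := ler_wpM2l (ltW d0) h2; lra.
apply/lee_addgt0Pr => d d0; rewrite -leeBlDr // -EFinB.
have [N0 HN0] := expr_gt 2 l1; have [N1 HN1] := nat_gt (ln 2 / (d / 2)).
pose N := maxn N0 N1.+1.
have N2 : 2 < lam ^+ N.
  apply: (lt_le_trans HN0); apply: ler_weXn2l; [exact: ltW|exact: leq_maxl].
have Nd : ln 2 <= d / 2 * N%:R.
  move: HN1; rewrite ltr_pdivrMr; last lra.
  have : N1%:R <= N%:R :> R by rewrite ler_nat ltnW // leq_maxr.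
  move=> h1 h2; have d2 : 0 <= d / 2 by lra.
  by have := ler_wpM2l d2 h1; lra.
have [eps [c [eps0 c0 H]]] := separated_growth l1 sF pF N2.
apply: (@le_trans _ _ (limn_esup (fun n : nat =>
    ((n%:R^-1)%:E * lne (max_separated F n eps))%E))); last first.
  apply: le_ereal_sup_tmp; eexists; last exact: lexx.
  by exists eps => //; rewrite /= in_itv /= eps0.
apply: limn_esup_ge => n0.
(* One half of [d] has paid for [ln 2 / N]; the other half, for large [j], absorbs [c] and the extra
   unit in the length [(j * N).+1]. *)
have [j0 Hj0] := nat_gt ((ln lam - ln c) / (d / 2)).
pose j := maxn n0 j0.
exists (j * N).+1.
  apply: leqW; apply: (leq_trans (leq_maxl n0 j0)).
  by rewrite leq_pmulr // /N leq_max orbT.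
have [s Hs cs] := H j.
have L0 : 0 < lam ^+ N / 2 by apply: divr_gt0 => //; lra.
have L1 : 0 < (lam ^+ N / 2) ^+ j by rewrite exprn_gt0.
apply: (@le_trans _ _ (((j * N).+1%:R^-1)%:E * (ln (c * (lam ^+ N / 2) ^+ j))%:E)%E); last first.
  apply: lee_wpmul2l; first by rewrite lee_fin invr_ge0.
  by apply: lne_max_separated_ge Hs cs; exact: mulr_gt0.
rewrite -EFinM lee_fin mulrC ler_pdivlMr ?ltr0n //.
rewrite lnM ?posrE // lnXn // ln_div ?posrE ?exprn_gt0 // lnXn //.
rewrite -natr1 natrM -[_ *+ j]mulr_natr -[ln lam *+ N]mulr_natr.
have jj0 : j0%:R <= j%:R :> R by rewrite ler_nat leq_maxr.
have jN : j%:R <= j%:R * N%:R :> R.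
  by rewrite -natrM ler_nat leq_pmulr // /N leq_max orbT.
have d2 : 0 <= d / 2 by lra.
have h1 := ler_wpM2l d2 (le_trans jj0 jN).
have h2 : j%:R * ln 2 <= j%:R * (d / 2 * N%:R) by apply: ler_wpM2l.
move: Hj0; rewrite ltr_pdivrMr; last lra.
by lra.
Qed.

End EntropyOfSlope.

(** * Conjugacy by increasing homeomorphisms and invariance of entropy *)

Section Conjugacy.
Variable R : realType.
Implicit Types (f F psi : R -> R) (x y : R).

Lemma increasing_homeo_sym psi psi' :
  increasing_homeo psi psi' -> increasing_homeo psi' psi.
Proof.
move=> [cp cp' k k' m]; split => // x y xI yI xy; rewrite ltNge; apply/negP.
rewrite le_eqVlt => /predU1P[E|/m].
  by move: xy; rewrite -(k' x) // -(k' y) // E ltxx.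
rewrite !k' // => /(_ (cp'.2 _ yI) (cp'.2 _ xI)) yx.
by move: (lt_trans xy yx); rewrite ltxx.
Qed.

Lemma increasing_homeo_le psi psi' x y : increasing_homeo psi psi' ->
  unitI R x -> unitI R y -> x <= y -> psi x <= psi y.
Proof.
move=> [_ _ _ _ m] xI yI; rewrite le_eqVlt => /predU1P[->//|xy].
by apply/ltW/m.
Qed.

Lemma within_uniform f : {within unitI R, continuous f} -> forall e, 0 < e ->
  exists2 d, 0 < d & forall x y, 0 <= x <= 1 -> 0 <= y <= 1 ->
    `|x - y| <= d -> `|f x - f y| <= e.
Proof.
move=> /within_continuous_eps cf e e0.
have [x xI|d d0 Hd] := @lebesgue_number R (fun x y => `|f x - f y| <= e).
  have e2 : 0 < e / 2 by lra.
  have [d d0 Hd] := cf x xI _ e2; exists d => // u v u0 uv v1 xu vx.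
  have h1 : `|f u - f x| < e / 2 by apply: Hd; rewrite ?ltr_norml; lra.
  have h2 : `|f v - f x| < e / 2 by apply: Hd; rewrite ?ltr_norml; lra.
  have := ler_normB (f u - f x) (f v - f x).
  by rewrite (_ : f u - f x - (f v - f x) = f u - f v); [lra|ring].
exists d => // x y xI yI; rewrite ler_norml => xy.
have [xly|/ltW ylx] := leP x y; first by apply: Hd; lra.
by rewrite distrC; apply: Hd; lra.
Qed.

Lemma conjugacy_sym f F psi psi' : increasing_homeo psi psi' -> stable01 F ->
  (forall x, unitI R x -> f x = psi (F (psi' x))) ->
  forall x, unitI R x -> F x = psi' (f (psi x)).
Proof.
move=> [cp cp' k k' m] sF H x xI; rewrite H; last exact: cp.2.
rewrite (k x) // k // unitIE; apply: sF; by rewrite -unitIE.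
Qed.

Lemma conjugacy_iter f F psi psi' n : increasing_homeo psi psi' -> stable01 F ->
  (forall x, unitI R x -> f x = psi (F (psi' x))) ->
  forall x, unitI R x -> iter n f x = psi (iter n F (psi' x)).
Proof.
move=> [cp cp' k k' m] sF H x xI; elim: n => [|n IH] /=; first by rewrite k'.
have nI : unitI R (iter n F (psi' x)).
  by rewrite unitIE; apply: iter_stable01 => //; rewrite -unitIE; exact: cp'.2.
by rewrite IH H ?k //; exact: cp.2.
Qed.

(** With [d] a modulus of uniform continuity of [psi] for [eps], [psi'] carries (n, eps)-separated
    sets of [f] to (n, d)-separated sets of [F] of the same size. *)
Lemma top_entropy_conj_le f F psi psi' : increasing_homeo psi psi' -> stable01 F ->
  (forall x, unitI R x -> f x = psi (F (psi' x))) ->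
  (top_entropy f <= top_entropy F)%E.
Proof.
move=> hp sF H; apply: ge_ereal_sup => h [eps /=]; rewrite in_itv /= andbT => eps0 <-.
have [cp cp' k k' m] := hp.
have [d d0 Hd] := within_uniform cp.1 eps0.
apply: (@le_trans _ _ (limn_esup (fun n : nat =>
    ((n%:R^-1)%:E * lne (max_separated F n d))%E))); last first.
  apply: le_ereal_sup_tmp; eexists; last exact: lexx.
  by exists d => //; rewrite /= in_itv /= d0.
apply: le_limn_esup => n; apply: lee_wpmul2l; first by rewrite lee_fin invr_ge0.
apply: lne_le; first exact: max_separated_ge0.
apply: ge_ereal_sup => _ [s [us sI ss] <-]; apply: le_ereal_sup_tmp.
have inj : {in s &, injective psi'}.
  by move=> x y xs ys E; rewrite -(k' x) ?E ?k' //; exact: sI.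
exists (size (map psi' s))%:R%:E; last by rewrite size_map.
exists (map psi' s) => //; split; first by rewrite map_inj_in_uniq.
  by move=> _ /mapP[x xs ->]; apply: cp'.2; exact: sI.
move=> _ _ /mapP[x xs ->] /mapP[y ys ->] xy.
have [|i lin hi] := ss x y xs ys; first by apply: contraNneq xy => ->.
exists i => //; rewrite ltNge; apply/negP => hd; move: hi.
rewrite !(conjugacy_iter i hp sF H); [|exact: sI|exact: sI].
have iI z : z \in s -> 0 <= iter i F (psi' z) <= 1.
  by move=> zs; apply: iter_stable01 => //; rewrite -unitIE; apply: cp'.2; exact: sI.
by rewrite ltNge Hd //; exact: iI.
Qed.

Lemma top_entropy_conj f F psi psi' : increasing_homeo psi psi' -> stable01 F ->
  stable01 f -> (forall x, unitI R x -> f x = psi (F (psi' x))) ->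
  top_entropy f = top_entropy F.
Proof.
move=> hp sF sf H; apply/eqP; rewrite eq_le (top_entropy_conj_le hp sF H) /=.
apply: (top_entropy_conj_le (increasing_homeo_sym hp) sf).
exact: (conjugacy_sym hp sF H).
Qed.

End Conjugacy.

(** * Turning points under conjugacy and perturbation *)

Section CriticalPoints.
Variable R : realType.
Implicit Types (f F G psi : R -> R) (a b c l L x y r : R) (s t : seq R).

Lemma increasing_homeo_fix psi psi' : increasing_homeo psi psi' ->
  psi 0 = 0 /\ psi 1 = 1.
Proof.
move=> hp; have [cp cp' k k' m] := hp.
have I0 : unitI R 0 by rewrite unitIE; lra.
have I1 : unitI R 1 by rewrite unitIE; lra.
have le z : unitI R z -> psi 0 <= psi z <= psi 1.
  move=> zI; have := zI; rewrite unitIE => /andP[z0 z1].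
  by rewrite !(increasing_homeo_le hp).
have := le _ (cp'.2 _ I0); have := le _ (cp'.2 _ I1); rewrite !k' //.
have := cp.2 _ I0; have := cp.2 _ I1; rewrite !unitIE.
by move=> ? ? ? ?; split; lra.
Qed.

Lemma increasing_homeo_interior psi psi' x : increasing_homeo psi psi' ->
  0 < x < 1 -> 0 < psi x < 1.
Proof.
move=> hp /andP[x0 x1]; have [p0 p1] := increasing_homeo_fix hp.
have [_ _ _ _ m] := hp.
have h0 : psi 0 < psi x by apply: m => //; rewrite unitIE; lra.
have h1 : psi x < psi 1 by apply: m => //; rewrite unitIE; lra.
by lra.
Qed.

Lemma Crit_conj f F psi psi' x : increasing_homeo psi psi' -> stable01 F ->
  (forall x, unitI R x -> f x = psi (F (psi' x))) ->
  0 < x < 1 -> Crit F x -> Crit f (psi x).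
Proof.
move=> hp sF H x01 Cx; have [cp cp' k k' m] := hp.
have H' := conjugacy_sym hp sF H.
right; split; first by apply: cp.2; rewrite unitIE; lra.
move=> [U /nbhs_ballP[e /= e0 HU] mU].
apply: (Crit_interior x01 Cx).
have xI : 0 <= x <= 1 by lra.
have [d d0 Hd] := (within_continuous_eps _ _ _).1 cp.1 x xI e e0.
exists (ball x d); first exact: nbhsx_ballx.
have VU y : (ball x d `&` unitI R) y -> (U `&` unitI R) (psi y).
  move=> [yx yI]; split; last exact: cp.2.
  apply: HU; rewrite /ball /= distrC; apply: Hd; first by rewrite -unitIE.
  by move: yx; rewrite /ball /= distrC.
have FI y : (ball x d `&` unitI R) y -> unitI R (f (psi y)).
  move=> [_ yI]; rewrite H ?k //; last exact: cp.2.
  by apply: cp.2; rewrite unitIE; apply: sF; rewrite -unitIE.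
case: mU => mU; [left|right] => y z yV zV yz;
  rewrite (H' y yV.2) (H' z zV.2);
  apply: (increasing_homeo_le (increasing_homeo_sym hp)); try exact: FI;
  apply: mU; try exact: VU;
  by apply: (increasing_homeo_le hp) => //; [exact: yV.2|exact: zV.2].
Qed.

(** Without critical points, the increments of [G] have absolute value exactly [l] times the length;
    on a zigzag they partly cancel, which makes the total too small. *)
Lemma zigzag_Crit G l a b c : {within unitI R, continuous G} ->
  has_constant_slope l G -> 0 <= a -> a < b -> b < c -> c <= 1 ->
  (G a < G b /\ G c < G b) \/ (G b < G a /\ G b < G c) ->
  exists2 y, a < y < c & Crit G y.
Proof.
move=> cG sG a0 ab bc c1 zz; apply: contrapT => nC.
have iso := @constant_slope_isometric R G l a c cG sG a0 c1 _.
have {}iso u v : a <= u -> u <= v -> v <= c -> `|G v - G u| = l * (v - u).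
  by apply: iso => y yac Cy; apply: nC; exists y.
have h1 := iso a b (lexx _) (ltW ab) (ltW bc).
have h2 := iso b c (ltW ab) (ltW bc) (lexx _).
have h3 := iso a c (lexx _) (ltW (lt_trans ab bc)) (lexx _).
case: zz => [[Gab Gcb]|[Gba Gbc]].
  rewrite gtr0_norm ?subr_gt0 // in h1; rewrite ltr0_norm ?subr_lt0 // in h2.
  have : `|G c - G a| < l * (c - a) by rewrite ltr_norml; lra.
  by rewrite h3 ltxx.
rewrite ltr0_norm ?subr_lt0 // in h1; rewrite gtr0_norm ?subr_gt0 // in h2.
have : `|G c - G a| < l * (c - a) by rewrite ltr_norml; lra.
by rewrite h3 ltxx.
Qed.

(** The one-sided slopes differ but have the same absolute value [L > 0], so they are opposite and
    [c] is a strict local extremum. *)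
Lemma Crit_zigzag F L c r : piecewise_affine L F -> 0 < L -> 0 < c < 1 ->
  Crit F c -> 0 < r -> exists u w,
  [/\ 0 <= u <= 1 /\ 0 <= w <= 1, c - r < u < c, c < w < c + r &
   (F u < F c /\ F w < F c) \/ (F c < F u /\ F c < F w)].
Proof.
move=> pF L0 cI Cc r0; have [|e [s [t [e0 sL tL Hs Ht]]]] := pF c; first lra.
pose d := Num.min (Num.min (e / 2) (r / 2)) (Num.min (c / 2) ((1 - c) / 2)).
have [d0 de dr dc dc1] : [/\ 0 < d, d <= e / 2, d <= r / 2, d <= c / 2 & d <= (1 - c) / 2].
  by rewrite /d !lt_min !ge_min !lexx !orbT; split => //; lra.
exists (c - d), (c + d); split; try lra.
rewrite (Ht (c - d)) ?(Hs (c + d)); try lra.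
have naff : s != t.
  apply/eqP => st; apply: (affine_at_not_Crit (L := L) (F := F) (x := c)) => //.
  exists e, s; split => // u uI cu; have [uc|/ltW cu'] := leP u c.
    by rewrite st; apply: Ht => //; lra.
  by apply: Hs => //; lra.
have Ld : 0 < L * d by rewrite mulr_gt0.
have [s0|s0] := leP 0 s; have [t0|t0] := leP 0 t.
- by case/eqP: naff; rewrite -(ger0_norm s0) -(ger0_norm t0) sL tL.
- have sE : s = L by rewrite -sL ger0_norm.
  have tE : t = - L by rewrite -tL ltr0_norm // opprK.
  by right; rewrite sE tE; lra.
- have sE : s = - L by rewrite -sL ltr0_norm // opprK.
  have tE : t = L by rewrite -tL ger0_norm.
  by left; rewrite sE tE; lra.
- case/eqP: naff; apply: oppr_inj.
  by rewrite -(ltr0_norm s0) -(ltr0_norm t0) sL tL.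
Qed.

Lemma seq_gap s : exists2 r, 0 < r &
  forall x y, x \in s -> y \in s -> x != y -> 2 * r <= `|x - y|.
Proof.
elim: s => [|z s [r r0 Hr]]; first by exists 1.
have [e e0 He] := @finite_set_gap R [set` s] z (finite_seq s).
exists (Num.min r (e / 2)); first by rewrite lt_min r0 divr_gt0.
have h1 : 2 * Num.min r (e / 2) <= 2 * r by rewrite ler_pM2l // ge_min lexx.
have h2 : 2 * Num.min r (e / 2) <= e.
  by rewrite mulrC -ler_pdivlMr // ge_min lexx orbT.
move=> x y; rewrite !inE => /predU1P[->|xs] /predU1P[->|ys] xy.
- by rewrite eqxx in xy.
- by apply: (le_trans h2); rewrite distrC; apply: He => //; rewrite eq_sym.
- by apply: (le_trans h2); apply: He.
- by apply: (le_trans h1); apply: Hr.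
Qed.

Lemma near_seq (T : eqType) (s : seq T) (P : T -> nat -> Prop) :
  (forall x : T, x \in s -> \forall n \near \oo, P x n) ->
  \forall n \near \oo, forall x : T, x \in s -> P x n.
Proof.
elim: s => [|z s IH] H; first by apply: nearW.
have h1 := H z (mem_head _ _).
have h2 : \forall n \near \oo, forall x : T, x \in s -> P x n.
  by apply: IH => x xs; apply: H; rewrite inE xs orbT.
near=> n => x; rewrite inE => /predU1P[->|]; first by near: n.
by move: x; near: n.
Unshelve. all: by end_near. Qed.

(* Each of the m turning points of F forces a nearby turning point of the
   perturbed map; the modality leaves no room for another one. *)
Lemma no_extra_critical_point F lam (h p q G : nat -> R -> R) (l : nat -> R) (m : nat)
    s (t : nat -> seq R) x :
  piecewise_affine lam F -> 0 < lam -> stable01 F ->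
  (forall e, 0 < e -> \forall n \near \oo, forall x, 0 <= x <= 1 -> `|h n x - F x| < e) ->
  (forall n, stable01 (h n)) ->
  (forall n, increasing_homeo (p n) (q n)) ->
  (forall n, {within unitI R, continuous (G n)}) ->
  (forall n, has_constant_slope (l n) (G n)) ->
  (forall n x, 0 <= x <= 1 -> G n (p n x) = p n (h n x)) ->
  uniq s -> size s = m -> (forall c, c \in s -> 0 < c < 1 /\ Crit F c) ->
  (forall n, size (t n) = m) ->
  (forall n y, 0 < y < 1 -> Crit (G n) y -> y \in t n) ->
  0 <= x <= 1 -> affine_at lam F x ->
  exists2 e, 0 < e & \forall n \near \oo, forall c,
    0 < c < 1 -> x - e < c < x + e -> ~ Crit (G n) (p n c).
Proof.
move=> pF lam0 sF hF sh hp cG sG conj us ss sC st tC xI ax.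
(* Including [x] makes its window of radius [r] disjoint from those of the turning points in [s]. *)
have [r r0 Hr] := seq_gap (x :: s).
have xs : x \notin s.
  by apply/negP => /sC[x01]; apply: affine_at_not_Crit ax x01.
have near_crit c : c \in s -> \forall n \near \oo,
    exists2 y, (0 < y < 1 /\ c - r < y < c + r) & Crit (G n) (p n y).
  move=> cs; have [cI Cc] := sC c cs.
  have [u [w [[uI wI] cu cw zz]]] := Crit_zigzag pF lam0 cI Cc r0.
  (* A quarter of the smaller height of the zigzag: it survives errors below [e] in its three
     values. *)
  have [e e0 He] : exists2 e, 0 < e & (F u + e < F c - e /\ F w + e < F c - e) \/
      (F c + e < F u - e /\ F c + e < F w - e).
    case: zz => zz; [exists (Num.min (F c - F u) (F c - F w) / 4)|
                     exists (Num.min (F u - F c) (F w - F c) / 4)].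
    - by rewrite divr_gt0 // lt_min; lra.
    - have h1 : Num.min (F c - F u) (F c - F w) <= F c - F u by rewrite ge_min lexx.
      have h2 : Num.min (F c - F u) (F c - F w) <= F c - F w.
        by rewrite ge_min lexx orbT.
      have h0 : 0 < Num.min (F c - F u) (F c - F w) by rewrite lt_min; lra.
      by left; lra.
    - by rewrite divr_gt0 // lt_min; lra.
    - have h1 : Num.min (F u - F c) (F w - F c) <= F u - F c by rewrite ge_min lexx.
      have h2 : Num.min (F u - F c) (F w - F c) <= F w - F c.
        by rewrite ge_min lexx orbT.
      have h0 : 0 < Num.min (F u - F c) (F w - F c) by rewrite lt_min; lra.
      by right; lra.
  near=> n.
  have hn : forall x, 0 <= x <= 1 -> `|h n x - F x| < e by near: n; exact: hF.
  have cI' : 0 <= c <= 1 by lra.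
  have := hn u uI; have := hn w wI; have := hn c cI'; rewrite !ltr_norml => hc hw hu.
  have [pc pc' k k' mp] := hp n.
  have pI z : 0 <= z <= 1 -> 0 <= p n z <= 1.
    by rewrite -!unitIE => /pc.2.
  have [|||||y uyw Cy] := @zigzag_Crit (G n) (l n) (p n u) (p n c) (p n w) (cG n) (sG n).
  - by have := pI u uI; lra.
  - by apply: mp; rewrite ?unitIE; lra.
  - by apply: mp; rewrite ?unitIE; lra.
  - by have := pI w wI; lra.
  - rewrite !conj //.
    have hI z : 0 <= z <= 1 -> unitI R (h n z) by rewrite unitIE; exact: sh.
    by case: He => He; [left|right]; split; apply: mp; try exact: hI; lra.
  have yI : 0 <= y <= 1 by have := pI u uI; have := pI w wI; lra.
  have kk : p n (q n y) = y by apply: k'; rewrite unitIE.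
  have qI : 0 <= q n y <= 1 by rewrite -unitIE; apply: pc'.2; rewrite unitIE.
  have uq : u < q n y.
    rewrite ltNge; apply/negP => qu; have : p n (q n y) <= p n u.
      by apply: (increasing_homeo_le (hp n)); rewrite ?unitIE.
    by rewrite kk; lra.
  have qw : q n y < w.
    rewrite ltNge; apply/negP => qu; have : p n w <= p n (q n y).
      by apply: (increasing_homeo_le (hp n)); rewrite ?unitIE.
    by rewrite kk; lra.
  by exists (q n y); [lra|rewrite kk].
have Hall := near_seq near_crit.
exists r => //; near=> n => c cI xc Cc.
have Hn : forall c, c \in s ->
    exists2 y, (0 < y < 1 /\ c - r < y < c + r) & Crit (G n) (p n y) by near: n.
have /boolp.choice[Y HY] d : exists y, d \in s ->
    (0 < y < 1 /\ d - r < y < d + r) /\ Crit (G n) (p n y).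
  have [/Hn[y y1 y2]|] := boolP (d \in s); first by exists y.
  by exists 0.
have apart d d' : d \in x :: s -> d' \in x :: s -> d != d' -> forall y,
    d - r < y < d + r -> d' - r < y < d' + r -> False.
  move=> ds ds' dd' y y1 y2; have := Hr d d' ds ds' dd'.
  by rewrite leNgt => /negP; apply; rewrite ltr_norml; lra.
have pinj : {in [pred y | 0 < y < 1] &, injective (p n)}.
  have [_ _ k _ _] := hp n => y z; rewrite !inE => yI zI E.
  by rewrite -(k y) ?E ?k // unitIE; lra.
have U : uniq (map (p n) (c :: map Y s)).
  rewrite map_inj_in_uniq; last first.
    move=> y z; rewrite !inE => ys zs; apply: pinj; rewrite inE.
      by case/predU1P: ys => [->//|/mapP[d /HY[[]] ? _ _ ->]].
    by case/predU1P: zs => [->//|/mapP[d /HY[[]] ? _ _ ->]].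
  rewrite /=; apply/andP; split.
    apply/negP => /mapP[d ds cE]; have [[_ Yd] _] := HY d ds.
    apply: (apart x d _ _ _ c) => //; rewrite ?inE ?eqxx ?ds ?orbT //.
      by apply: contraNneq xs => ->.
    by rewrite cE.
  rewrite map_inj_in_uniq // => d d' ds ds' E.
  apply/eqP; apply: contraT => dd'; exfalso.
  have [[_ Yd] _] := HY d ds; have [[_ Yd'] _] := HY d' ds'.
  by apply: (apart d d' _ _ dd' (Y d)); rewrite ?inE ?ds ?ds' ?orbT // E.
have sub : {subset map (p n) (c :: map Y s) <= t n}.
  move=> _ /mapP[y ys ->]; move: ys; rewrite inE => /predU1P[->|/mapP[d ds ->]].
    by apply: tC => //; apply: increasing_homeo_interior (hp n) cI.
  have [[Yd _] CY] := HY d ds.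
  by apply: tC => //; apply: increasing_homeo_interior (hp n) Yd.
(* With [c], there would be [m + 1] distinct entries in a list of length [m]. *)
by have := uniq_leq_size U sub; rewrite size_map /= size_map ss st ltnn.
Unshelve. all: by end_near. Qed.

End CriticalPoints.

(** * Limits along ultrafilters *)

Section UltrafilterLimit.
Variable R : realType.

Lemma ultralimit (U : set_system nat) (a : nat -> R) : UltraFilter U ->
  (forall n, 0 <= a n <= 1) -> exists l : R, a n @[n --> U] --> l.
Proof.
move=> ultraU aI; have pU : ProperFilter U := ultra_proper.
pose S := [set t | U [set n | t <= a n]].
have S0 : S 0 by apply: filterS filterT => n _; case/andP: (aI n).
have ubS : ubound S 1.
  by move=> t /filter_ex[n /= ta]; apply: (le_trans ta); case/andP: (aI n).
have hS : has_sup S by split; [exists 0|exists 1].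
exists (sup S); apply/cvgrPdist_lt => e e0.
have [t St te] := sup_adherent e0 hS.
have e2 : 0 < e / 2 by lra.
have [bad|good] := in_ultra_setVsetC [set n | sup S + e / 2 <= a n] ultraU.
  have : sup S + e / 2 <= sup S by apply: ub_le_sup => //; exists 1.
  by lra.
have : U ([set n | t <= a n] `&` ~` [set n | sup S + e / 2 <= a n]) by apply: filterI.
apply: filterS => n /= [ta /negP]; rewrite -ltNge => an.
by rewrite ltr_norml; lra.
Qed.

(** The filter at infinity restricted to the complement of [A] is proper, and an ultrafilter extends
    it. *)
Lemma bad_ultrafilter (A : set nat) : ~ (\forall n \near \oo, A n) ->
  exists U : set_system nat, [/\ UltraFilter U, \oo `<=` U & U (~` A)].
Proof.
move=> nA.
have pW : ProperFilter (within (~` A) \oo).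
  apply: Build_ProperFilter_ex => // B HB.
  rewrite /within /= in HB.
  apply: contrapT => nB; apply: nA; apply: filterS HB => n Bn.
  by apply: contrapT => nAn; apply: nB; exists n; exact: Bn.
have [U [ultraU WU]] := ultraFilterLemma pW.
exists U; split => //.
  by move=> B HB; apply: WU; rewrite /within /=; apply: filterS HB => n Bn _.
by apply: WU; rewrite /within /=; apply: nearW => n.
Qed.

End UltrafilterLimit.

(** * Conjugacies of nearby maps tend to the identity *)

Section PerturbationLimit.
Variables (R : realType) (F : R -> R) (lam : R).
Variables (h p q G : nat -> R -> R) (l : nat -> R).
Implicit Types (a b d e u v x y : R).
Hypothesis lam1 : 1 < lam.
Hypothesis pF : piecewise_affine lam F.
Hypothesis sF : stable01 F.
Hypothesis tF : transitive_map F.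
Hypothesis hF : forall e, 0 < e ->
  \forall n \near \oo, forall x, 0 <= x <= 1 -> `|h n x - F x| < e.
Hypothesis sh : forall n, stable01 (h n).
Hypothesis hp : forall n, increasing_homeo (p n) (q n).
Hypothesis cG : forall n, {within unitI R, continuous (G n)}.
Hypothesis sG : forall n, has_constant_slope (l n) (G n).
Hypothesis pG : forall n, piecewise_affine (l n) (G n).
Hypothesis conj : forall n x, 0 <= x <= 1 -> G n (p n x) = p n (h n x).
Hypothesis lcvg : l n @[n --> \oo] --> lam.
Hypothesis noextra : forall x, 0 <= x <= 1 -> affine_at lam F x ->
  exists2 e, 0 < e & \forall n \near \oo, forall c,
    0 < c < 1 -> x - e < c < x + e -> ~ Crit (G n) (p n c).

(* p n, extended by 0 and 1 outside the unit interval. *)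
Let P n x := p n (clamp01 x).

Let l0 : 0 < lam. Proof. exact: lt_trans ltr01 lam1. Qed.

Let PE n x : 0 <= x <= 1 -> P n x = p n x.
Proof. by move=> xI; rewrite /P clamp01_id. Qed.

Let pI n x : 0 <= x <= 1 -> 0 <= p n x <= 1.
Proof. by have [cp _ _ _ _] := hp n; rewrite -!unitIE => /cp.2. Qed.

Let PI n x : 0 <= P n x <= 1.
Proof. exact/pI/clamp01_itv. Qed.

Let mP n : {homo P n : x y / x <= y}.
Proof.
move=> x y xy; apply: (increasing_homeo_le (hp n)); rewrite ?unitIE ?clamp01_itv //.
by have := clamp01_diff xy; lra.
Qed.

Lemma ultralimit_id (U : set_system nat) x : UltraFilter U -> \oo `<=` U ->
  0 <= x <= 1 -> P n x @[n --> U] --> x.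
Proof.
move=> ultraU Uoo; have pU : ProperFilter U := ultra_proper.
have lU : l n @[n --> U] --> lam by apply: cvg_trans lcvg => A; exact: Uoo.
have /boolp.choice[phi Hphi] y : exists z : R, P n y @[n --> U] --> z.
  exact: ultralimit.
have diff u v : P n v - P n u @[n --> U] --> phi v - phi u by exact: cvgB.
have l0' := l0.
suff idphi : forall y, 0 <= y <= 1 -> phi y = y by move=> /idphi {2}<-; exact: Hphi.
have Ucvg y c : (forall n, P n y = c) -> phi y = c.
  move=> H; apply: (cvg_unique _ (Hphi y)) => //.
  by rewrite (_ : P^~ y = (fun=> c)); [exact: cvg_cst|exact/boolp.funext].
apply: (conformal_distribution_id lam1 pF sF) => //.
- by move=> y z yz; apply: ler_cvg_to (Hphi y) (Hphi z) _; apply: nearW => n; exact: mP.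
- move=> z z0; apply: Ucvg => n; rewrite /P clamp01_lt0 //.
  exact: (increasing_homeo_fix (hp n)).1.
- move=> z z1; apply: Ucvg => n; rewrite /P clamp01_gt1 //.
  exact: (increasing_homeo_fix (hp n)).2.
- move=> a b u v aI bI Fau uv vFb.
  have uI : 0 <= u <= 1 by have := sF aI; have := sF bI; lra.
  have vI : 0 <= v <= 1 by have := sF aI; have := sF bI; lra.
  apply: (ler_cvg_to (diff u v) (cvgM lU (cvg_norm (diff a b)))).
  have e0 : 0 < Num.min (u - F a) (F b - v) by rewrite lt_min; lra.
  apply: Uoo; apply: filterS (hF e0) => n Hn.
  have m1 : Num.min (u - F a) (F b - v) <= u - F a by rewrite ge_min lexx.
  have m2 : Num.min (u - F a) (F b - v) <= F b - v by rewrite ge_min lexx orbT.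
  have := Hn a aI; have := Hn b bI; rewrite !ltr_norml => hb ha.
  (* [u, v] lies between [h n a] and [h n b]; the conjugacy turns [p n (h n a)] into [G n (p n a)],
     where the Lipschitz constant is [l n]. *)
  have gl := piecewise_affine_lipschitz (pG n) (pI n bI) (pI n aI).
  suff H : p n v - p n u <= l n * `|p n b - p n a| by rewrite /= !PE.
  apply: le_trans gl; rewrite !conj //.
  have h1 : p n (h n a) <= p n u.
    by apply: (increasing_homeo_le (hp n)); rewrite ?unitIE //; [exact: sh|lra].
  have h2 : p n v <= p n (h n b).
    by apply: (increasing_homeo_le (hp n)); rewrite ?unitIE //; [exact: sh|lra].
  by have := ler_norm (p n (h n b) - p n (h n a)); lra.
move=> y e yI ay e0.
have [e1 e10 He1] := noextra yI ay.
(* [d <= e1 / 2] stays in the window free of critical points; [lam * d <= e / 4] keeps [F], and then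
   [h n], within [e] of [F y]. *)
pose d := Num.min (e1 / 2) (e / (4 * lam)).
have d0 : 0 < d by rewrite lt_min !divr_gt0 //; lra.
have de1 : d <= e1 / 2 by rewrite ge_min lexx.
have de : d * (4 * lam) <= e by rewrite -ler_pdivlMr; [rewrite ge_min lexx orbT|lra].
exists d => //.
apply: (ler_cvg_to (cvgM lU (diff _ _)) (diff _ _)).
have e4 : 0 < e / 4 by lra.
apply: Uoo; apply: filterS2 (hF e4) He1 => n Hn nC /=.
rewrite /P; set u := clamp01 (y - d); set v := clamp01 (y + d).
have uI : 0 <= u <= 1 by exact: clamp01_itv.
have vI : 0 <= v <= 1 by exact: clamp01_itv.
have uy : 0 <= y - u <= d.
  have := @clamp01_diff R (y - d) y; rewrite (clamp01_id yI) => /(_ _) H.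
  have {}H : 0 <= y - u <= y - (y - d) by apply: H; lra.
  by lra.
have vy : 0 <= v - y <= d.
  have := @clamp01_diff R y (y + d); rewrite (clamp01_id yI) => /(_ _) H.
  have {}H : 0 <= v - y <= y + d - y by apply: H; lra.
  by lra.
have uv : p n u <= p n v by apply: (increasing_homeo_le (hp n)); rewrite ?unitIE //; lra.
have := pI n uI; have := pI n vI => pvI puI.
have [cp cq k k' mp] := hp n.
have nC' c : p n u < c < p n v -> ~ Crit (G n) c.
  move=> cuv.
  have cI : unitI R c by rewrite unitIE; lra.
  have qI : 0 <= q n c <= 1 by rewrite -unitIE; exact: cq.2.
  have uq : u < q n c.
    rewrite ltNge; apply/negP => qu; have : p n (q n c) <= p n u.
      by apply: (increasing_homeo_le (hp n)); rewrite ?unitIE.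
    by rewrite k' //; lra.
  have qv : q n c < v.
    rewrite ltNge; apply/negP => qu; have : p n v <= p n (q n c).
      by apply: (increasing_homeo_le (hp n)); rewrite ?unitIE.
    by rewrite k' //; lra.
  by have := nC (q n c); rewrite k' //; apply; lra.
have pu0 : 0 <= p n u by lra.
have pv1 : p n v <= 1 by lra.
(* Without a critical point in between, [l n] times the length from [p n u] to [p n v] is exactly
   the distance from [p n (h n u)] to [p n (h n v)]. *)
rewrite -(constant_slope_isometric (@cG n) (@sG n) pu0 pv1 nC' (lexx _) uv (lexx _)).
rewrite !conj //.
have near z : 0 <= z <= 1 -> `|z - y| <= d -> F y - e <= h n z <= F y + e.
  move=> zI zd; have := Hn z zI; have := piecewise_affine_lipschitz pF zI yI.
  have := ler_wpM2l (ltW l0) zd => h1 h2.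
  have : `|F z - F y| <= e / 4 by lra.
  by rewrite ler_norml ltr_norml; lra.
have hu : F y - e <= h n u <= F y + e by apply: near => //; rewrite ler_norml; lra.
have hv : F y - e <= h n v <= F y + e by apply: near => //; rewrite ler_norml; lra.
have inP z : 0 <= z <= 1 -> F y - e <= z <= F y + e ->
    p n (clamp01 (F y - e)) <= p n z <= p n (clamp01 (F y + e)).
  move=> zI /andP[z1 z2]; rewrite -(PE n zI); apply/andP.
  by split; exact: mP.
have := inP _ (sh n uI) hu; have := inP _ (sh n vI) hv.
by rewrite ler_norml; lra.
Qed.

Lemma conjugacies_cvg_id x e : 0 <= x <= 1 -> 0 < e ->
  \forall n \near \oo, `|p n x - x| < e.
Proof.
move=> xI e0; apply: contrapT => /bad_ultrafilter[U [ultraU Uoo nU]].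
have pU : ProperFilter U := ultra_proper.
have /cvgrPdist_lt /(_ e e0) H := ultralimit_id ultraU Uoo xI.
have [n [/= h1]] := filter_ex (filterI H nU).
by rewrite PE // distrC in h1; rewrite h1.
Qed.

(** Pointwise convergence of monotone functions to a continuous limit is uniform: the values on a
    grid of mesh below [e / 2] trap all others. *)
Lemma conjugacies_ucvg_id e : 0 < e ->
  \forall n \near \oo, forall x, 0 <= x <= 1 -> `|p n x - x| < e.
Proof.
move=> e0; have [K HK] := nat_gt (2 / e).
have K0 : 0 < K%:R :> R by apply: lt_trans HK; apply: divr_gt0.
have e2 : 0 < e / 2 by lra.
pose s := [seq i%:R / K%:R : R | i <- iota 0 K.+1].
have sI y : y \in s -> 0 <= y <= 1.
  move=> /mapP[i]; rewrite mem_iota /= add0n ltnS => iK ->.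
  by rewrite divr_ge0 ?ler0n //= ler_pdivrMr // mul1r ler_nat.
have Hs : \forall n \near \oo, forall y : R, y \in s -> `|p n y - y| < e / 2.
  by apply: near_seq => y ys; apply: conjugacies_cvg_id => //; exact: sI.
apply: filterS Hs => n Hn x xI.
have Ke : K%:R^-1 < e / 2.
  move: HK; rewrite ltr_pdivrMr // => HK.
  by rewrite invf_plt ?posrE // invf_div ltr_pdivrMr //; lra.
have mp u v : 0 <= u <= 1 -> 0 <= v <= 1 -> u <= v -> p n u <= p n v.
  by move=> uI vI; apply: (increasing_homeo_le (hp n)); rewrite unitIE.
(* The last grid point has no cell to its right. *)
have [x1|x1] := eqVneq x 1.
  apply: lt_trans (_ : e / 2 < e); last by lra.
  rewrite x1; apply: Hn; apply/mapP; exists K; first by rewrite mem_iota /= add0n.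
  by rewrite divff // gt_eqF.
have xlt1 : x < 1 by rewrite lt_neqAle x1; case/andP: xI.
have xK : 0 <= x * K%:R by rewrite mulr_ge0 ?ler0n //; case/andP: xI.
have /andP[i1 i2] := truncn_itv xK; set i := Num.truncn _ in i1 i2.
have iK : (i < K)%N.
  rewrite -(ltr_nat R); apply: (le_lt_trans i1).
  by rewrite -[ltRHS]mul1r ltr_pM2r.
have si : i%:R / K%:R \in s.
  by apply/mapP; exists i => //; rewrite mem_iota /= add0n ltnW.
have si1 : i.+1%:R / K%:R \in s.
  by apply/mapP; exists i.+1 => //; rewrite mem_iota /= add0n ltnS.
have h1 : i%:R / K%:R <= x by rewrite ler_pdivrMr.
have h2 : x <= i.+1%:R / K%:R by rewrite ler_pdivlMr // ltW.
have h3 : i.+1%:R / K%:R = i%:R / K%:R + K%:R^-1 :> R by rewrite -natr1 mulrDl mul1r.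
have := Hn _ si; have := Hn _ si1; rewrite !ltr_norml.
have := mp _ _ (sI _ si) xI h1; have := mp _ _ xI (sI _ si1) h2.
rewrite h3; move: h1 h2; rewrite h3; lra.
Qed.

(** With [z = q n y], [G n y = p n (h n z)] is compared in turn with [h n z], [F z] and [F y]. Here
    [z] is close to [y = p n z] because [p n] is close to the identity, so the same estimate covers
    the inverses. *)
Theorem conjugates_ucvg e : 0 < e ->
  \forall n \near \oo, forall y, 0 <= y <= 1 -> `|G n y - F y| < e.
Proof.
move=> e0; have l0' := l0.
pose d := Num.min (e / 4) (e / (4 * lam)).
have d0 : 0 < d by rewrite lt_min !divr_gt0 //; lra.
have d1 : d <= e / 4 by rewrite ge_min lexx.
have d2 : d * (4 * lam) <= e by rewrite -ler_pdivlMr; [rewrite ge_min lexx orbT|lra].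
have e4 : 0 < e / 4 by lra.
apply: filterS2 (conjugacies_ucvg_id d0) (hF e4) => n H1 H2 y yI.
have [cp cq k k' mp] := hp n.
have qI : 0 <= q n y <= 1 by rewrite -unitIE; apply: cq.2; rewrite unitIE.
have yE : y = p n (q n y) by rewrite k' // unitIE.
have h1 := H1 _ (sh n qI); have h2 := H2 _ qI; have h3 := H1 _ qI.
rewrite -yE in h3.
have h4 := piecewise_affine_lipschitz pF qI yI.
have h5 := ler_wpM2l (ltW l0) (ltW h3); rewrite distrC in h5.
have -> : G n y = p n (h n (q n y)) by rewrite {1}yE conj.
have h6 : `|F (q n y) - F y| <= e / 4 by lra.
by move: h1 h2 h6; rewrite !ltr_norml ler_norml; lra.
Qed.

End PerturbationLimit.

(** * Uniform convergence in epsilon form, and the conclusion *)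

Section UniformConvergence.
Variable R : realType.

Lemma uniform_cvgP (g : nat -> R -> R) (f : R -> R) :
  {uniform unitI R, g @ \oo --> f} <->
  forall e, 0 < e -> \forall n \near \oo, forall x, 0 <= x <= 1 -> `|g n x - f x| < e.
Proof.
split.
  move=> H e e0.
  have : nbhs (f : {uniform` unitI R -> R}) [set u | forall x, unitI R x -> `|u x - f x| < e].
    apply/uniform_nbhs; exists [set xy | ball xy.1 e xy.2].
    split; first exact: (entourage_ball _ (PosNum e0)).
    by move=> u Hu x xI; have := Hu x xI; rewrite /ball /= distrC.
  move=> /H HH.
  have {}HH : \forall n \near \oo, forall x, unitI R x -> `|g n x - f x| < e := HH.
  by apply: filterS HH => n Hn x xI; apply: Hn; rewrite unitIE.
move=> H P /uniform_nbhs[E [entE EP]].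
move: entE; rewrite -entourage_ballE => -[e /= e0 He].
apply: filterS (H e e0) => n Hn; apply: EP => x xI; apply: He.
by rewrite /ball /= distrC; apply: Hn; rewrite -unitIE.
Qed.

Lemma card_seq (A : set R) m : (A #= `I_m)%card ->
  exists t : seq R, [/\ uniq t, size t = m & forall y, A y <-> y \in t].
Proof.
move=> Am; have fA : finite_set A by apply/finite_setP; exists m.
exists (enum_fset (fset_set A)); split; first exact: fset_uniq.
  exact: (card_fset_set Am).
by move=> y; rewrite (in_fset_set fA y) in_setE.
Qed.

End UniformConvergence.

Lemma T_space_constant_slope (R : realType) (F : R -> R) (lam : R) :
  T_space F -> has_constant_slope lam F ->
  [/\ {within unitI R, continuous F}, stable01 F, piecewise_affine lam F & 1 < lam].
Proof.
move=> [[cF sF'] tF fC] sF.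
have sF01 : stable01 F by move=> x; rewrite -!unitIE; exact: sF'.
have pF := constant_slope_piecewise_affine cF fC sF.
by split => //; exact: piecewise_affine_gt1 pF sF01 tF.
Qed.

Unset Implicit Arguments.
Set Strict Implicit.

Theorem theorem3 (R : realType) (m : nat)
    (g : nat -> R -> R) (f : R -> R)
    (Phi_g : nat -> R -> R) (Phi_f : R -> R) :
  (forall n, T_modality m (g n)) ->
  T_modality m f ->
  {uniform unitI R, g @ \oo --> f} ->
  top_entropy (g n) @[n --> \oo] --> top_entropy f ->
  (forall n, constant_slope_model (g n) (Phi_g n)) ->
  constant_slope_model f Phi_f ->
  {uniform unitI R, Phi_g @ \oo --> Phi_f}.
Proof.
move=> Tg Tf gf htop Mg Mf.
have [TF [lam sF] [psi [psi' [hpsi cjF]]]] := Mf.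
have [cF sF01 pF lam1] := T_space_constant_slope TF sF.
have lam0 : 0 < lam by lra.
have [[cpsi cpsi' kpsi kpsi' mpsi] [_ tF _]] := (hpsi, TF).
have /boolp.choice[w Hw] n : exists w : R * ((R -> R) * (R -> R)),
    [/\ has_constant_slope w.1 (Phi_g n), increasing_homeo w.2.1 w.2.2 &
      forall x, unitI R x -> g n x = w.2.1 (Phi_g n (w.2.2 x))].
  by have [_ [l sG] [ps [ps' [hp cj]]]] := Mg n; exists (l, (ps, ps')).
pose l n := (w n).1; pose ps n := (w n).2.1; pose ps' n := (w n).2.2.
have sG n : has_constant_slope (l n) (Phi_g n) by have [] := Hw n.
have hps n : increasing_homeo (ps n) (ps' n) by have [] := Hw n.
have cjG n : forall x, unitI R x -> g n x = ps n (Phi_g n (ps' n x)) by have [] := Hw n.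
have TG n : T_space (Phi_g n) by have [] := Mg n.
have factG n := T_space_constant_slope (TG n) (sG n).
have cG n : {within unitI R, continuous (Phi_g n)} by have [] := factG n.
have sG01 n : stable01 (Phi_g n) by have [] := factG n.
have pG n : piecewise_affine (l n) (Phi_g n) by have [] := factG n.
have l1 n : 1 < l n by have [] := factG n.
have sf01 : stable01 f by have [[[_ +] _ _] _] := Tf => H x; rewrite -!unitIE; exact: H.
have sg01 n : stable01 (g n).
  by have [[[_ +] _ _] _] := Tg n => H x; rewrite -!unitIE; exact: H.
(* Conjugacy invariance turns the hypothesis on entropies into convergence of [ln (l n)]; the
   exponential recovers the slopes. *)
have lcvg : l n @[n --> \oo] --> lam.
  have lncvg : ln (l n) @[n --> \oo] --> ln lam.
    suff : (ln (l n))%:E @[n --> \oo] --> (ln lam)%:E by move=> /fine_cvg.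
    move: htop; rewrite (top_entropy_conj hpsi sF01 sf01 cjF).
    rewrite (top_entropy_piecewise_affine lam1 sF01 pF).
    rewrite (_ : (fun n => top_entropy (g n)) = (fun n => (ln (l n))%:E)) //.
    apply/boolp.funext => n; rewrite (top_entropy_conj (hps n) (sG01 n) (sg01 n) (cjG n)).
    exact: top_entropy_piecewise_affine.
  rewrite -(lnK (x := lam)) ?posrE //.
  rewrite (_ : l = fun n => expR (ln (l n))); last first.
    by apply/boolp.funext => n; rewrite lnK // posrE; have := l1 n; lra.
  exact: (continuous_cvg _ (@continuous_expR R _) lncvg).
pose h n x := psi' (g n (psi x)).
(* [psi] leaves the coordinates of [Phi_f], and [ps' n] enters those of [Phi_g n]. *)
pose p n x := ps' n (psi x).
pose q n x := psi' (ps n x).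
have psiI x : 0 <= x <= 1 -> 0 <= psi x <= 1 by rewrite -!unitIE; exact: cpsi.2.
have psiI' x : 0 <= x <= 1 -> 0 <= psi' x <= 1 by rewrite -!unitIE; exact: cpsi'.2.
have hp n : increasing_homeo (p n) (q n).
  have [cps cps' kps kps' mps] := hps n.
  have [_ _ _ _ mps'] := increasing_homeo_sym (hps n).
  split.
  - split; last by move=> x xI; apply/cps'.2/cpsi.2.
    apply/within_continuous_eps => x xI e e0.
    have [d d0 Hd] := (within_continuous_eps _ _ _).1 cps'.1 _ (psiI x xI) e e0.
    have [d' d'0 Hd'] := (within_continuous_eps _ _ _).1 cpsi.1 x xI d d0.
    by exists d' => // y yI yx; apply: Hd; [exact: psiI|exact: Hd'].
  - split; last by move=> x xI; apply/cpsi'.2/cps.2.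
    apply/within_continuous_eps => x xI e e0.
    have psI y : 0 <= y <= 1 -> 0 <= ps n y <= 1 by rewrite -!unitIE; exact: cps.2.
    have [d d0 Hd] := (within_continuous_eps _ _ _).1 cpsi'.1 _ (psI x xI) e e0.
    have [d' d'0 Hd'] := (within_continuous_eps _ _ _).1 cps.1 x xI d d0.
    by exists d' => // y yI yx; apply: Hd; [exact: psI|exact: Hd'].
  - by move=> x xI; rewrite /p /q kps' ?kpsi //; exact: cpsi.2.
  - by move=> x xI; rewrite /p /q kpsi' ?kps //; exact: cps.2.
  - move=> x y xI yI xy; apply: mps'; [exact: cpsi.2|exact: cpsi.2|exact: mpsi].
have sh n : stable01 (h n) by move=> x xI; apply/psiI'/sg01/psiI.
have conj n x : 0 <= x <= 1 -> Phi_g n (p n x) = p n (h n x).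
  move=> xI; have [cps cps' kps kps' mps] := hps n.
  rewrite (conjugacy_sym (hps n) (sG01 n) (cjG n)); last first.
    by apply: cps'.2; rewrite unitIE; exact: psiI.
  rewrite /p /h kps' ?kpsi' // unitIE; last exact: psiI.
  by apply/sg01/psiI.
have hF e : 0 < e ->
    \forall n \near \oo, forall x, 0 <= x <= 1 -> `|h n x - Phi_f x| < e.
  move=> e0; have e2 : 0 < e / 2 by lra.
  have [d d0 Hd] := within_uniform cpsi'.1 e2.
  apply: filterS ((uniform_cvgP g f).1 gf d d0) => n Hn x xI.
  rewrite (conjugacy_sym hpsi sF01 cjF) ?unitIE // /h.
  apply: le_lt_trans (_ : e / 2 < e); last by lra.
  by apply: Hd; [exact/sg01/psiI|exact/sf01/psiI|apply/ltW/Hn/psiI].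
have [tf [utf stf Htf]] := card_seq Tf.2.
have /boolp.choice[tg Htg] n : exists t : seq R,
    [/\ uniq t, size t = m & forall y, (Crit (g n) `&` `]0, 1[%classic) y <-> y \in t].
  exact: card_seq (Tg n).2.
have [_ _ _ _ mpsi'] := increasing_homeo_sym hpsi.
have in01 y : y \in tf -> 0 < y < 1 /\ Crit f y.
  by move=> /Htf[Cy]; rewrite /= in_itv.
apply/uniform_cvgP => e e0.
apply: (conjugates_ucvg lam1 pF sF01 tF hF sh hp cG sG pG conj lcvg) => // x xI ax.
(* The homeomorphisms carry the interior critical points of [f] and [g n] to those of their models,
   so both lists have length [m]. *)
apply: (@no_extra_critical_point R Phi_f lam h p q Phi_g l m (map psi' tf)
    (fun n => map (ps' n) (tg n)) x) => //.
- rewrite map_inj_in_uniq // => y z /in01[yI _] /in01[zI _] E.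
  by rewrite -(kpsi' y) ?E ?kpsi' // unitIE; lra.
- by rewrite size_map.
- move=> _ /mapP[y /in01[yI Cy] ->].
  split; first exact: increasing_homeo_interior (increasing_homeo_sym hpsi) yI.
  apply: (Crit_conj (increasing_homeo_sym hpsi) sf01 _ yI Cy).
  exact: conjugacy_sym hpsi sF01 cjF.
- by move=> n; rewrite size_map; have [] := Htg n.
- move=> n y yI Cy; have [_ _ Ht] := Htg n.
  have [_ _ kps _ _] := hps n.
  apply/mapP; exists (ps n y); last by rewrite kps // unitIE; lra.
  apply/Ht; split; first exact: (Crit_conj (hps n) (sG01 n) (cjG n) yI Cy).
  by rewrite /= in_itv /=; exact: increasing_homeo_interior (hps n) yI.
Qed.
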